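(* Let $\mathcal M=(\mathcal C,\mathsf T)$ be a CBPV model that is adequate with respect to a given program relation $\preccurlyeq$. If $\mathsf T$ is lax idempotent, then for every source-language expression $\Gamma\vdash e:\tau$ we have $$\mathcal V(e)\ \preccurlyeq_{\mathrm{ctx}}\ \Psi_\tau\big(\mathcal N(e)[\hat\Phi_\Gamma]\big),$$ where both sides are computations of type $\mathbf F(\mathcal V(\tau))$ in the context $\mathcal V(\Gamma)$.
   Context: **Order-enriched notions.** A Poset-category is a category $\mathcal C$ with a partial order $\sqsubseteq$ on each hom-set such that composition is monotone. It is cartesian if it has a terminal object $1$ (unique maps $\langle\rangle_X:X\to 1$) and binary products (projections $\pi_i$) with monotone pairing $\langle-,-\rangle$; $\mathrm{assoc}:(X_1\times X_2)\times X_3\to X_1\times(X_2\times X_3)$ is the canonical isomorphism. It is cartesian closed if moreover it has exponentials $X\Rightarrow Y$ with monotone currying $\Lambda:\mathcal C(W\times X,Y)\to\mathcal C(W,X\Rightarrow Y)$. Binary coproducts are required to have monotone copairing $[-,-]$. A strong Poset-monad $\mathsf T$ on a cartesian $\mathcal C$ consists of objects $TX$, morphisms $\eta_X:X\to TX$, and monotone functions $(-)^{\dagger(W\times\square)}:\mathcal C(W\times X,TY)\to\mathcal C(W\times TX,TY)$ such that: $f^{\dagger(W\times\square)}\circ(w\times \mathrm{id})=(f\circ(w\times\mathrm{id}))^{\dagger(W'\times\square)}$ for $w:W'\to W$; $f^{\dagger(W\times\square)}\circ(\mathrm{id}_W\times\eta_X)=f$; $(\eta_X\circ\pi_2)^{\dagger(1\times\square)}=\pi_2$;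 and $(g^{\dagger(W'\times\square)}\circ(\mathrm{id}_{W'}\times f)\circ\mathrm{assoc})^{\dagger((W'\times W)\times\square)}=g^{\dagger(W'\times\square)}\circ(\mathrm{id}_{W'}\times f^{\dagger(W\times\square)})\circ\mathrm{assoc}$ for $f:W\times X\to TY$, $g:W'\times Y\to TZ$. A $\mathsf T$-algebra $\mathsf Z$ is an object $Z=U_{\mathsf T}\mathsf Z$ (the carrier) with monotone functions $(-)^{\ddagger(W\times\square)}:\mathcal C(W\times X,Z)\to\mathcal C(W\times TX,Z)$ satisfying the same naturality in $W$, the left unit law $f^{\ddagger(W\times\square)}\circ(\mathrm{id}_W\times\eta_X)=f$, and associativity $(g^{\ddagger(W'\times\square)}\circ(\mathrm{id}_{W'}\times f)\circ\mathrm{assoc})^{\ddagger((W'\times W)\times\square)}=g^{\ddagger(W'\times\square)}\circ(\mathrm{id}_{W'}\times f^{\dagger(W\times\square)})\circ\mathrm{assoc}$ for $f:W\times X\to TY$, $g:W'\times Y\to Z$. For $f:X\to TY$, $f^\dagger:TX\to TY$ is the case $W=1$ (using $1\times X\cong X$), and $Tf=(\eta_Y\circ f)^\dagger$ for $f:X\to Y$. $\mathsf T$ is lax idempotent if $T\eta_Y\sqsubseteq\eta_{TY}$ for every object $Y$. Algebra constructions: the free algebra $F_{\mathsf T}X$ has carrier $TX$ and extension $(-)^{\dagger(W\times\square)}$; the product $\mathsf Z_1\times\mathsf Z_2$ has carrier $Z_1\times Z_2$ and $f^{\ddagger(W\times\square)}=\langle(\pi_1\circ f)^{\ddagger(W\times\square)},(\pi_2\circ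 f)^{\ddagger(W\times\square)}\rangle$; the power $Y\Rightarrow\mathsf Z$ has carrier $Y\Rightarrow Z$ and $f^{\ddagger(W\times\square)}=\Lambda\big((\Lambda^{-1}f\circ\beta_{W,Y,X})^{\ddagger((W\times Y)\times\square)}\circ\beta_{W,TX,Y}\big)$, where $\beta_{X_1,X_2,X_3}:(X_1\times X_2)\times X_3\to(X_1\times X_3)\times X_2$ is the canonical isomorphism. A (CBPV) model $\mathcal M=(\mathcal C,\mathsf T)$ is a cartesian closed Poset-category $\mathcal C$ admitting the coproduct $2=1+1$ (coprojections $\mathrm{inl},\mathrm{inr}$), with a strong Poset-monad $\mathsf T$. Then $W+W$ exists for all $W$, and $\mathrm{dist}_W:W\times2\to W+W$ denotes the inverse of the canonical map. **Call-by-push-value (CBPV).** Value types $A::=\mathbf{unit}\mid A_1\times A_2\mid\mathbf{bool}\mid\mathbf U\,\underline C$; computation types $\underline C::=\underline C_1\underline\times\,\underline C_2\mid A\to\underline C\mid\mathbf F A$. Values $V::=x\mid()\mid(V_1,V_2)\mid\mathbf{true}\mid\mathbf{false}\mid\mathbf{thunk}\,M$. Computations $M::=\lambda\{1.M_1,2.M_2\}\mid 1\text{`}M\mid2\text{`}M\mid\lambda x{:}A.M\mid V\text{`}M\mid\mathbf{return}\,V\mid M\,\mathbf{to}\,x.\,N\mid\mathbf{match}\,V\,\mathbf{with}\,(x_1,x_2).M\mid\mathbf{if}\,V\,\mathbf{then}\,M_1\,\mathbf{else}\,M_2\mid\mathbf{force}\,V$. Contexts are lists of distinct variables with value types. Value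 typing $\Gamma\vdash V:A$ is the evident one, with $\Gamma\vdash\mathbf{thunk}\,M:\mathbf U\underline C$ if $\Gamma\vdash_c M:\underline C$. Computation typing $\Gamma\vdash_cM:\underline C$: $\lambda\{1.M_1,2.M_2\}:\underline C_1\underline\times\,\underline C_2$ if $M_i:\underline C_i$; $i\text{`}M:\underline C_i$ if $M:\underline C_1\underline\times\,\underline C_2$; $\lambda x{:}A.M:A\to\underline C$ if $\Gamma,x:A\vdash_cM:\underline C$; $V\text{`}M:\underline C$ if $V:A$, $M:A\to\underline C$ (application of $M$ to $V$); $\mathbf{return}\,V:\mathbf FA$ if $V:A$; $M\,\mathbf{to}\,x.N:\underline C$ if $M:\mathbf FA$ and $\Gamma,x:A\vdash_cN:\underline C$; match and if are the evident eliminators of $A_1\times A_2$ and $\mathbf{bool}$ into any $\underline C$; $\mathbf{force}\,V:\underline C$ if $V:\mathbf U\underline C$. Interpretation in a model: $[\![\mathbf{unit}]\!]=1$, $[\![A_1\times A_2]\!]=[\![A_1]\!]\times[\![A_2]\!]$, $[\![\mathbf{bool}]\!]=2$, $[\![\mathbf U\underline C]\!]=U_{\mathsf T}[\![\underline C]\!]$; as $\mathsf T$-algebras, $[\![\underline C_1\underline\times\,\underline C_2]\!]=[\![\underline C_1]\!]\times[\![\underline C_2]\!]$, $[\![A\to\underline C]\!]=[\![A]\!]\Rightarrow[\![\underline C]\!]$, $[\![\mathbf FA]\!]=F_{\mathsf T}[\![A]\!]$; contexts are products. $[\![\Gamma\vdash V:A]\!]:[\![\Gamma]\!]\to[\![A]\!]$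 and $[\![\Gamma\vdash_cM:\underline C]\!]:[\![\Gamma]\!]\to U_{\mathsf T}[\![\underline C]\!]$ are: $[\![x]\!]=\pi_x$, $[\![()]\!]=\langle\rangle$, $[\![(V_1,V_2)]\!]=\langle[\![V_1]\!],[\![V_2]\!]\rangle$, $[\![\mathbf{true}]\!]=\mathrm{inl}\circ\langle\rangle$, $[\![\mathbf{false}]\!]=\mathrm{inr}\circ\langle\rangle$, $[\![\mathbf{thunk}\,M]\!]=[\![M]\!]$, $[\![\lambda\{1.M_1,2.M_2\}]\!]=\langle[\![M_1]\!],[\![M_2]\!]\rangle$, $[\![i\text{`}M]\!]=\pi_i\circ[\![M]\!]$, $[\![\lambda x.M]\!]=\Lambda[\![M]\!]$, $[\![V\text{`}M]\!]=\Lambda^{-1}[\![M]\!]\circ\langle\mathrm{id},[\![V]\!]\rangle$, $[\![\mathbf{return}\,V]\!]=\eta\circ[\![V]\!]$, $[\![M\,\mathbf{to}\,x.N]\!]=[\![N]\!]^{\ddagger([\![\Gamma]\!]\times\square)}\circ\langle\mathrm{id},[\![M]\!]\rangle$, $[\![\mathbf{match}\,V\,\mathbf{with}\,(x,y).M]\!]=[\![M]\!]\circ\mathrm{assoc}^{-1}\circ\langle\mathrm{id},[\![V]\!]\rangle$, $[\![\mathbf{if}\,V\,\mathbf{then}\,M_1\,\mathbf{else}\,M_2]\!]=[[\![M_1]\!],[\![M_2]\!]]\circ\mathrm{dist}\circ\langle\mathrm{id},[\![V]\!]\rangle$, $[\![\mathbf{force}\,V]\!]=[\![V]\!]$. A program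 is a closed computation of type $\mathbf F\,\mathbf{bool}$. A program relation is a preorder $\preccurlyeq$ on programs. For $\Gamma\vdash_cM,M':\underline C$, write $M\preccurlyeq_{\mathrm{ctx}}M'$ if $\mathcal E[M]\preccurlyeq\mathcal E[M']$ for every computation context $\mathcal E$ (computation term with a single hole where a computation is expected; filling may capture variables) such that $\mathcal E[M],\mathcal E[M']$ are programs. A model is adequate with respect to $\preccurlyeq$ if $[\![\Gamma\vdash_cM:\underline C]\!]\sqsubseteq[\![\Gamma\vdash_cM':\underline C]\!]$ implies $M\preccurlyeq_{\mathrm{ctx}}M'$, for all such $M,M'$. **Source language.** Types $\tau::=\mathbf{unit}\mid\mathbf{bool}\mid\tau_1\times\tau_2\mid\tau\to\tau'$; expressions $e::=x\mid()\mid(e_1,e_2)\mid\mathbf{fst}\,e\mid\mathbf{snd}\,e\mid\mathbf{true}\mid\mathbf{false}\mid\mathbf{if}\,e_0\,\mathbf{then}\,e_1\,\mathbf{else}\,e_2\mid\lambda x{:}\tau.e\mid e\,e'$, with the usual simply typed rules $\Gamma\vdash e:\tau$. **Call-by-value translation.** $\mathcal V(\mathbf{unit})=\mathbf{unit}$, $\mathcal V(\mathbf{bool})=\mathbf{bool}$, $\mathcal V(\tau_1\times\tau_2)=\mathcal V(\tau_1)\times\mathcal V(\tau_2)$, $\mathcal V(\tau\to\tau')=\mathbf U(\mathcal V(\tau)\to\mathbf F\mathcal V(\tau'))$; $\mathcal V(x_1{:}\tau_1,\dots)=x_1{:}\mathcal V(\tau_1),\dots$. For $\Gamma\vdash e:\tau$,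 $\mathcal V(\Gamma)\vdash_c\mathcal V(e):\mathbf F\mathcal V(\tau)$: $x\mapsto\mathbf{return}\,x$; $()\mapsto\mathbf{return}\,()$; $(e_1,e_2)\mapsto\mathcal V(e_1)\,\mathbf{to}\,z_1.\,\mathcal V(e_2)\,\mathbf{to}\,z_2.\,\mathbf{return}\,(z_1,z_2)$; $\mathbf{fst}\,e\mapsto\mathcal V(e)\,\mathbf{to}\,z.\,\mathbf{match}\,z\,\mathbf{with}\,(z_1,z_2).\mathbf{return}\,z_1$, similarly $\mathbf{snd}$; $\mathbf{true}\mapsto\mathbf{return}\,\mathbf{true}$, $\mathbf{false}\mapsto\mathbf{return}\,\mathbf{false}$; $\mathbf{if}\,e_0\,\mathbf{then}\,e_1\,\mathbf{else}\,e_2\mapsto\mathcal V(e_0)\,\mathbf{to}\,z.\,\mathbf{if}\,z\,\mathbf{then}\,\mathcal V(e_1)\,\mathbf{else}\,\mathcal V(e_2)$; $\lambda x{:}\tau.e\mapsto\mathbf{return}\,\mathbf{thunk}\,\lambda x{:}\mathcal V(\tau).\mathcal V(e)$; $e\,e'\mapsto\mathcal V(e)\,\mathbf{to}\,y.\,\mathcal V(e')\,\mathbf{to}\,z.\,z\text{`}\mathbf{force}\,y$. **Call-by-name translation.** $\mathcal N(\mathbf{unit})=\mathbf F\,\mathbf{unit}$, $\mathcal N(\mathbf{bool})=\mathbf F\,\mathbf{bool}$, $\mathcal N(\tau_1\times\tau_2)=\mathcal N(\tau_1)\underline\times\,\mathcal N(\tau_2)$, $\mathcal N(\tau\to\tau')=\mathbf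 U\mathcal N(\tau)\to\mathcal N(\tau')$; $\mathcal N(x_1{:}\tau_1,\dots)=x_1{:}\mathbf U\mathcal N(\tau_1),\dots$. For $\Gamma\vdash e:\tau$, $\mathcal N(\Gamma)\vdash_c\mathcal N(e):\mathcal N(\tau)$: $x\mapsto\mathbf{force}\,x$; $()\mapsto\mathbf{return}\,()$; $(e_1,e_2)\mapsto\lambda\{1.\mathcal N(e_1),2.\mathcal N(e_2)\}$; $\mathbf{fst}\,e\mapsto1\text{`}\mathcal N(e)$; $\mathbf{snd}\,e\mapsto2\text{`}\mathcal N(e)$; $\mathbf{true}\mapsto\mathbf{return}\,\mathbf{true}$, $\mathbf{false}\mapsto\mathbf{return}\,\mathbf{false}$; $\mathbf{if}\,e_0\,\mathbf{then}\,e_1\,\mathbf{else}\,e_2\mapsto\mathcal N(e_0)\,\mathbf{to}\,z.\,\mathbf{if}\,z\,\mathbf{then}\,\mathcal N(e_1)\,\mathbf{else}\,\mathcal N(e_2)$; $\lambda x{:}\tau.e\mapsto\lambda x{:}\mathbf U\mathcal N(\tau).\mathcal N(e)$; $e\,e'\mapsto(\mathbf{thunk}\,\mathcal N(e'))\text{`}\mathcal N(e)$. (Auxiliary variables are fresh.) **Maps between evaluation orders.** $\Phi_\tau$ sends $\Gamma\vdash_cM:\mathbf F\mathcal V(\tau)$ to $\Gamma\vdash_c\Phi_\tau M:\mathcal N(\tau)$, and $\Psi_\tau$ sends $\Gamma\vdash_cN:\mathcal N(\tau)$ to $\Gamma\vdash_c\Psi_\tau N:\mathbf F\mathcal V(\tau)$,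 by mutual induction: $\Phi_{\mathbf{unit}}M=M$, $\Phi_{\mathbf{bool}}M=M$, $\Phi_{\tau_1\times\tau_2}M=\lambda\{1.\,M\,\mathbf{to}\,x.\,\mathbf{match}\,x\,\mathbf{with}\,(z_1,z_2).\Phi_{\tau_1}(\mathbf{return}\,z_1),\ 2.\,M\,\mathbf{to}\,x.\,\mathbf{match}\,x\,\mathbf{with}\,(z_1,z_2).\Phi_{\tau_2}(\mathbf{return}\,z_2)\}$, $\Phi_{\tau\to\tau'}M=\lambda x{:}\mathbf U\mathcal N(\tau).\,M\,\mathbf{to}\,f.\,\Psi_\tau(\mathbf{force}\,x)\,\mathbf{to}\,y.\,\Phi_{\tau'}(y\text{`}\mathbf{force}\,f)$; $\Psi_{\mathbf{unit}}N=N$, $\Psi_{\mathbf{bool}}N=N$, $\Psi_{\tau_1\times\tau_2}N=\Psi_{\tau_1}(1\text{`}N)\,\mathbf{to}\,z_1.\,\Psi_{\tau_2}(2\text{`}N)\,\mathbf{to}\,z_2.\,\mathbf{return}\,(z_1,z_2)$, $\Psi_{\tau\to\tau'}N=\mathbf{return}\,\mathbf{thunk}\,\lambda x{:}\mathcal V(\tau).\,\Psi_{\tau'}\big((\mathbf{thunk}\,(\Phi_\tau(\mathbf{return}\,x)))\text{`}N\big)$. For $\Gamma=x_1:\tau_1,\dots,x_k:\tau_k$, $\hat\Phi_\Gamma$ is the simultaneous substitution $x_i\mapsto\mathbf{thunk}(\Phi_{\tau_i}(\mathbf{return}\,x_i))$, which turns computations in context $\mathcal N(\Gamma)$ into computations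 in context $\mathcal V(\Gamma)$. *)

(* Defs.v *)
From Stdlib Require Import List Relations.Relation_Definitions.
Import ListNotations.

Set Implicit Arguments.
Unset Strict Implicit.
Unset Printing Implicit Defensive.

Record PosetCategory := {
  Obj :> Type;
  Hom : Obj -> Obj -> Type;
  hle : forall X Y, Hom X Y -> Hom X Y -> Prop;
  idm : forall X, Hom X X;
  cmp : forall X Y Z, Hom Y Z -> Hom X Y -> Hom X Z;
  hle_order : forall X Y, order (Hom X Y) (@hle X Y);
  cmp_mono : forall X Y Z (g g' : Hom Y Z) (f f' : Hom X Y),
    hle g g' -> hle f f' -> hle (cmp g f) (cmp g' f');
  cmp_id_l : forall X Y (f : Hom X Y), cmp (idm Y) f = f;
  cmp_id_r : forall X Y (f : Hom X Y), cmp f (idm X) = f;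
  cmp_assoc : forall W X Y Z (h : Hom Y Z) (g : Hom X Y) (f : Hom W X),
    cmp h (cmp g f) = cmp (cmp h g) f
}.
Arguments Hom {p} X Y.
Arguments hle {p X Y} f g.
Arguments idm {p} X.
Arguments cmp {p X Y Z} g f.

Declare Scope cat_scope.
Delimit Scope cat_scope with cat.
Local Open Scope cat_scope.
Notation "g ∘ f" := (cmp g f) (at level 40, left associativity) : cat_scope.
Notation "f ⊑ g" := (hle f g) (at level 70, no associativity) : cat_scope.

Record CartesianCategory := {
  cart_cat :> PosetCategory;
  one : cart_cat;
  bang : forall X : cart_cat, Hom X one;
  bang_uniq : forall (X : cart_cat) (f : Hom X one), f = bang X;
  prd : cart_cat -> cart_cat -> cart_cat;
  pr1 : forall X1 X2, Hom (prd X1 X2) X1;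
  pr2 : forall X1 X2, Hom (prd X1 X2) X2;
  pairing : forall W X1 X2 : cart_cat, Hom W X1 -> Hom W X2 -> Hom W (prd X1 X2);
  pairing_mono : forall W X1 X2 (f1 f1' : Hom W X1) (f2 f2' : Hom W X2),
    f1 ⊑ f1' -> f2 ⊑ f2' -> pairing f1 f2 ⊑ pairing f1' f2';
  pr1_pairing : forall W X1 X2 (f1 : Hom W X1) (f2 : Hom W X2),
    pr1 X1 X2 ∘ pairing f1 f2 = f1;
  pr2_pairing : forall W X1 X2 (f1 : Hom W X1) (f2 : Hom W X2),
    pr2 X1 X2 ∘ pairing f1 f2 = f2;
  pairing_uniq : forall W X1 X2 (h : Hom W (prd X1 X2)),
    h = pairing (pr1 X1 X2 ∘ h) (pr2 X1 X2 ∘ h)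
}.
Arguments one {c}.
Arguments bang {c} X.
Arguments prd {c} X1 X2.
Arguments pr1 {c X1 X2}.
Arguments pr2 {c X1 X2}.
Arguments pairing {c W X1 X2} f1 f2.

Notation "X × Y" := (prd X Y) (at level 40, left associativity) : cat_scope.
Notation "⟨ f , g ⟩" := (pairing f g) (at level 0, format "⟨ f ,  g ⟩") : cat_scope.

Section Cartesian.
Variable C : CartesianCategory.
Implicit Types V W X Y Z : C.

Definition pmap W W' X X' (f : Hom W W') (g : Hom X X') : Hom (W × X) (W' × X') :=
  ⟨f ∘ pr1, g ∘ pr2⟩.

Definition assoc X1 X2 X3 : Hom ((X1 × X2) × X3) (X1 × (X2 × X3)) :=
  ⟨pr1 ∘ pr1, ⟨pr2 ∘ pr1, pr2⟩⟩.

Definition assoc_inv X1 X2 X3 : Hom (X1 × (X2 × X3)) ((X1 × X2) × X3) :=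
  ⟨⟨pr1, pr1 ∘ pr2⟩, pr2 ∘ pr2⟩.

Definition beta X1 X2 X3 : Hom ((X1 × X2) × X3) ((X1 × X3) × X2) :=
  ⟨⟨pr1 ∘ pr1, pr2⟩, pr2 ∘ pr1⟩.

Lemma pairing_cmp V W X Y (f : Hom W X) (g : Hom W Y) (h : Hom V W) :
  ⟨f, g⟩ ∘ h = ⟨f ∘ h, g ∘ h⟩.
Proof.
  rewrite (pairing_uniq (⟨f, g⟩ ∘ h)), !cmp_assoc, pr1_pairing, pr2_pairing.
  reflexivity.
Qed.

Lemma pairing_pr X Y : ⟨@pr1 C X Y, pr2⟩ = idm (X × Y).
Proof. rewrite (pairing_uniq (idm (X × Y))), !cmp_id_r. reflexivity. Qed.

Lemma cmp_pr1_pairing V W X Y (f : Hom W X) (g : Hom W Y) (k : Hom X V) :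
  k ∘ pr1 ∘ ⟨f, g⟩ = k ∘ f.
Proof. rewrite <- cmp_assoc, pr1_pairing. reflexivity. Qed.

Lemma cmp_pr2_pairing V W X Y (f : Hom W X) (g : Hom W Y) (k : Hom Y V) :
  k ∘ pr2 ∘ ⟨f, g⟩ = k ∘ g.
Proof. rewrite <- cmp_assoc, pr2_pairing. reflexivity. Qed.

Lemma cmp_pairing_cmp U V W X Y (k : Hom (X × Y) U)
    (f : Hom W X) (g : Hom W Y) (h : Hom V W) :
  k ∘ ⟨f, g⟩ ∘ h = k ∘ ⟨f ∘ h, g ∘ h⟩.
Proof. rewrite <- cmp_assoc, pairing_cmp. reflexivity. Qed.

Lemma bang_eq X (f g : Hom X one) : f = g.
Proof. rewrite (bang_uniq f), (bang_uniq g). reflexivity. Qed.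

End Cartesian.

Ltac cart := repeat progress (unfold pmap, assoc, assoc_inv, beta;
  rewrite ?cmp_assoc, ?pairing_cmp, ?cmp_pairing_cmp, ?pr1_pairing, ?pr2_pairing,
    ?cmp_pr1_pairing, ?cmp_pr2_pairing, ?cmp_id_l, ?cmp_id_r, ?pairing_pr).

Lemma assoc_assoc_inv (C : CartesianCategory) (X1 X2 X3 : C) :
  assoc X1 X2 X3 ∘ assoc_inv X1 X2 X3 = idm _ /\
  assoc_inv X1 X2 X3 ∘ assoc X1 X2 X3 = idm _.
Proof.
  split; cart.
  - rewrite <- pairing_cmp, pairing_pr. cart. reflexivity.
  - rewrite <- pairing_cmp, pairing_pr. cart. reflexivity.
Qed.

Record CartesianClosedCategory := {
  ccc_cart :> CartesianCategory;
  expo : ccc_cart -> ccc_cart -> ccc_cart;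
  ev : forall X Y : ccc_cart, Hom (expo X Y × X) Y;
  curry : forall W X Y : ccc_cart, Hom (W × X) Y -> Hom W (expo X Y);
  curry_mono : forall W X Y (f f' : Hom (W × X) Y), f ⊑ f' -> curry f ⊑ curry f';
  ev_curry : forall W X Y (f : Hom (W × X) Y),
    ev X Y ∘ pmap (curry f) (idm X) = f;
  curry_uniq : forall W X Y (h : Hom W (expo X Y)),
    h = curry (ev X Y ∘ pmap h (idm X))
}.
Arguments expo {c} X Y.
Arguments ev {c X Y}.
Arguments curry {c W X Y} f.

Notation "X ⇒ Y" := (expo X Y) (at level 55, right associativity) : cat_scope.

Section Closed.
Variable C : CartesianClosedCategory.
Implicit Types V W X Y Z : C.

Definition uncurry W X Y (h : Hom W (X ⇒ Y)) : Hom (W × X) Y :=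
  ev ∘ pmap h (idm X).

Lemma uncurry_curry W X Y (f : Hom (W × X) Y) : uncurry (curry f) = f.
Proof. apply ev_curry. Qed.

Lemma curry_uncurry W X Y (h : Hom W (X ⇒ Y)) : curry (uncurry h) = h.
Proof. symmetry. apply curry_uniq. Qed.

Lemma uncurry_inj W X Y (h h' : Hom W (X ⇒ Y)) : uncurry h = uncurry h' -> h = h'.
Proof.
  intro E. rewrite <- (curry_uncurry h), <- (curry_uncurry h'), E. reflexivity.
Qed.

Lemma uncurry_cmp V W X Y (h : Hom W (X ⇒ Y)) (w : Hom V W) :
  uncurry (h ∘ w) = uncurry h ∘ pmap w (idm X).
Proof. unfold uncurry. cart. reflexivity. Qed.

Lemma curry_cmp V W X Y (f : Hom (W × X) Y) (w : Hom V W) :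
  curry f ∘ w = curry (f ∘ pmap w (idm X)).
Proof.
  apply uncurry_inj. rewrite uncurry_cmp, !uncurry_curry. reflexivity.
Qed.

Lemma uncurry_mono W X Y (h h' : Hom W (X ⇒ Y)) : h ⊑ h' -> uncurry h ⊑ uncurry h'.
Proof.
  intro H. unfold uncurry, pmap.
  apply cmp_mono; [apply hle_order|].
  apply pairing_mono; [|apply hle_order].
  apply cmp_mono; [exact H|apply hle_order].
Qed.

End Closed.

Record Coproduct (C : PosetCategory) (X1 X2 : C) := {
  coprod_obj :> C;
  inl : Hom X1 coprod_obj;
  inr : Hom X2 coprod_obj;
  copair : forall Y : C, Hom X1 Y -> Hom X2 Y -> Hom coprod_obj Y;
  copair_mono : forall Y (f1 f1' : Hom X1 Y) (f2 f2' : Hom X2 Y),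
    f1 ⊑ f1' -> f2 ⊑ f2' -> copair f1 f2 ⊑ copair f1' f2';
  copair_inl : forall Y (f1 : Hom X1 Y) (f2 : Hom X2 Y), copair f1 f2 ∘ inl = f1;
  copair_inr : forall Y (f1 : Hom X1 Y) (f2 : Hom X2 Y), copair f1 f2 ∘ inr = f2;
  copair_uniq : forall Y (h : Hom coprod_obj Y), h = copair (h ∘ inl) (h ∘ inr)
}.
Arguments inl {C X1 X2} c.
Arguments inr {C X1 X2} c.
Arguments copair {C X1 X2} c {Y} f1 f2.

Section Double.
Variables (C : CartesianClosedCategory) (two : Coproduct (@one C) one).
Implicit Types W Y : C.

Definition pick1 W : Hom W (W × two) := ⟨idm W, inl two ∘ bang W⟩.
Definition pick2 W : Hom W (W × two) := ⟨idm W, inr two ∘ bang W⟩.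

Definition split_two W Y (f g : Hom W Y) : Hom (W × two) Y :=
  uncurry (copair two (curry (f ∘ pr2)) (curry (g ∘ pr2))) ∘ ⟨pr2, pr1⟩.

Lemma split_two_mono W Y (f f' g g' : Hom W Y) :
  f ⊑ f' -> g ⊑ g' -> split_two f g ⊑ split_two f' g'.
Proof.
  intros Hf Hg. unfold split_two.
  apply cmp_mono; [|apply hle_order].
  apply uncurry_mono, copair_mono; apply curry_mono, cmp_mono;
    first [assumption | apply hle_order].
Qed.

Lemma split_two_pick1 W Y (f g : Hom W Y) : split_two f g ∘ pick1 W = f.
Proof.
  unfold split_two, pick1. cart.
  transitivity (uncurry (copair two (curry (f ∘ pr2)) (curry (g ∘ pr2)))
    ∘ pmap (inl two) (idm W) ∘ ⟨bang W, idm W⟩).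
  - cart. reflexivity.
  - rewrite <- uncurry_cmp, copair_inl, uncurry_curry. cart. reflexivity.
Qed.

Lemma split_two_pick2 W Y (f g : Hom W Y) : split_two f g ∘ pick2 W = g.
Proof.
  unfold split_two, pick2. cart.
  transitivity (uncurry (copair two (curry (f ∘ pr2)) (curry (g ∘ pr2)))
    ∘ pmap (inr two) (idm W) ∘ ⟨bang W, idm W⟩).
  - cart. reflexivity.
  - rewrite <- uncurry_cmp, copair_inr, uncurry_curry. cart. reflexivity.
Qed.

Lemma split_two_uniq W Y (h : Hom (W × two) Y) :
  h = split_two (h ∘ pick1 W) (h ∘ pick2 W).
Proof.
  unfold split_two, pick1, pick2.
  transitivity (uncurry (curry (h ∘ ⟨pr2, pr1⟩)) ∘ ⟨pr2, pr1⟩).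
  { rewrite uncurry_curry. cart. reflexivity. }
  f_equal. f_equal.
  etransitivity; [apply copair_uniq|].
  rewrite !curry_cmp.
  f_equal; f_equal; cart;
    rewrite <- (cmp_assoc _ (bang W)), (bang_eq (bang W ∘ pr2) pr1); reflexivity.
Qed.

(* In a cartesian closed category W × 2 is a coproduct of W with itself, so it
   is taken as the chosen W + W; the canonical map W + W -> W × 2, and hence its
   inverse dist, are then identities.  dist_choice below shows that no other
   choice of W + W changes [f, g] ∘ dist. *)
Definition double W : Coproduct W W := {|
  coprod_obj := W × two;
  inl := pick1 W;
  inr := pick2 W;
  copair := @split_two W;
  copair_mono := fun Y f f' g g' => @split_two_mono W Y f f' g g';
  copair_inl := @split_two_pick1 W;
  copair_inr := @split_two_pick2 W;
  copair_uniq := @split_two_uniq W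
|}.

Definition canon W (S : Coproduct W W) : Hom S (W × two) :=
  copair S ⟨idm W, inl two ∘ bang W⟩ ⟨idm W, inr two ∘ bang W⟩.

Definition dist W : Hom (W × two) (double W) := idm (W × two).

Lemma dist_canon W :
  dist W ∘ canon (double W) = idm _ /\ canon (double W) ∘ dist W = idm _.
Proof.
  assert (E : canon (double W) = idm (W × two)).
  { rewrite (copair_uniq (c := double W) (idm (W × two))).
    unfold canon. rewrite !cmp_id_l. reflexivity. }
  rewrite E. unfold dist. split; apply cmp_id_l.
Qed.

Lemma dist_choice W (S : Coproduct W W) (d : Hom (W × two) S) Y (f g : Hom W Y) :
  d ∘ canon S = idm _ ->
  copair S f g ∘ d = copair (double W) f g ∘ dist W.
Proof.
  intro E. unfold dist. rewrite cmp_id_r. simpl.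
  assert (E1 : d ∘ pick1 W = inl S).
  { transitivity (d ∘ (canon S ∘ inl S)).
    - unfold canon. rewrite copair_inl. reflexivity.
    - rewrite cmp_assoc, E. apply cmp_id_l. }
  assert (E2 : d ∘ pick2 W = inr S).
  { transitivity (d ∘ (canon S ∘ inr S)).
    - unfold canon. rewrite copair_inr. reflexivity.
    - rewrite cmp_assoc, E. apply cmp_id_l. }
  rewrite (split_two_uniq (copair S f g ∘ d)), <- !cmp_assoc, E1, E2,
    copair_inl, copair_inr.
  reflexivity.
Qed.

End Double.

Record StrongMonad (C : CartesianCategory) := {
  T : C -> C;
  eta : forall X, Hom X (T X);
  ext : forall W X Y, Hom (W × X) (T Y) -> Hom (W × T X) (T Y);
  ext_mono : forall W X Y (f f' : Hom (W × X) (T Y)), f ⊑ f' -> ext f ⊑ ext f';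
  ext_nat : forall W W' X Y (f : Hom (W × X) (T Y)) (w : Hom W' W),
    ext f ∘ pmap w (idm (T X)) = ext (f ∘ pmap w (idm X));
  ext_eta : forall W X Y (f : Hom (W × X) (T Y)),
    ext f ∘ pmap (idm W) (eta X) = f;
  ext_unit : forall X, ext (eta X ∘ @pr2 C one X) = pr2;
  ext_ext : forall W W' X Y Z (f : Hom (W × X) (T Y)) (g : Hom (W' × Y) (T Z)),
    ext (ext g ∘ pmap (idm W') f ∘ assoc W' W X)
    = ext g ∘ pmap (idm W') (ext f) ∘ assoc W' W (T X)
}.
Arguments eta {C} s X.
Arguments ext {C} s {W X Y} f.

Section Monad.
Variables (C : CartesianCategory) (TT : StrongMonad C).

Definition kleisli (X Y : C) (f : Hom X (T TT Y)) : Hom (T TT X) (T TT Y) :=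
  ext TT (f ∘ @pr2 C one X) ∘ ⟨bang (T TT X), idm (T TT X)⟩.

Definition Tmap (X Y : C) (f : Hom X Y) : Hom (T TT X) (T TT Y) :=
  kleisli (eta TT Y ∘ f).

Definition lax_idempotent : Prop :=
  forall Y : C, Tmap (eta TT Y) ⊑ eta TT (T TT Y).

Record Algebra := {
  carrier : C;
  aext : forall W X : C, Hom (W × X) carrier -> Hom (W × T TT X) carrier;
  aext_mono : forall W X (f f' : Hom (W × X) carrier), f ⊑ f' -> aext f ⊑ aext f';
  aext_nat : forall W W' X (f : Hom (W × X) carrier) (w : Hom W' W),
    aext f ∘ pmap w (idm (T TT X)) = aext (f ∘ pmap w (idm X));
  aext_eta : forall W X (f : Hom (W × X) carrier),
    aext f ∘ pmap (idm W) (eta TT X) = f;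
  aext_ext : forall W W' X Y (f : Hom (W × X) (T TT Y)) (g : Hom (W' × Y) carrier),
    aext (aext g ∘ pmap (idm W') f ∘ assoc W' W X)
    = aext g ∘ pmap (idm W') (ext TT f) ∘ assoc W' W (T TT X)
}.

Definition free_alg (X : C) : Algebra := {|
  carrier := T TT X;
  aext := fun W Y f => ext TT f;
  aext_mono := fun W Y f f' => @ext_mono C TT W Y X f f';
  aext_nat := fun W W' Y f w => @ext_nat C TT W W' Y X f w;
  aext_eta := fun W Y f => @ext_eta C TT W Y X f;
  aext_ext := fun W W' Y Z f g => @ext_ext C TT W W' Y Z X f g
|}.

Program Definition prod_alg (Z1 Z2 : Algebra) : Algebra := {|
  carrier := carrier Z1 × carrier Z2;
  aext := fun W X f => ⟨aext (pr1 ∘ f), aext (pr2 ∘ f)⟩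
|}.
Next Obligation.
  apply pairing_mono; apply aext_mono, cmp_mono; first [assumption | apply hle_order].
Qed.
Next Obligation.
  rewrite pairing_cmp, !aext_nat, !cmp_assoc. reflexivity.
Qed.
Next Obligation.
  rewrite pairing_cmp, !aext_eta. symmetry. apply pairing_uniq.
Qed.
Next Obligation.
  rewrite !pairing_cmp, <- !aext_ext, pr1_pairing, pr2_pairing.
  reflexivity.
Qed.

End Monad.

Section Power.
Variables (C : CartesianClosedCategory) (TT : StrongMonad C).

Program Definition power_alg (Y : C) (Z : Algebra TT) : Algebra TT := {|
  carrier := Y ⇒ carrier Z;
  aext := fun W X f =>
    curry (aext (uncurry f ∘ beta W Y X) ∘ beta W (T TT X) Y)
|}.
Next Obligation.
  apply curry_mono, cmp_mono; [|apply hle_order].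
  apply aext_mono, cmp_mono; [|apply hle_order].
  apply uncurry_mono; assumption.
Qed.
Next Obligation.
  rewrite curry_cmp. f_equal.
  transitivity (aext (uncurry f ∘ beta W Y X)
    ∘ pmap (pmap w (idm Y)) (idm (T TT X)) ∘ beta W' (T TT X) Y).
  - cart. reflexivity.
  - rewrite aext_nat, uncurry_cmp. do 2 f_equal. cart. reflexivity.
Qed.
Next Obligation.
  rewrite curry_cmp.
  transitivity (curry (aext (uncurry f ∘ beta W Y X)
    ∘ pmap (idm (W × Y)) (eta TT X) ∘ beta W X Y)).
  - f_equal. cart. reflexivity.
  - rewrite aext_eta. transitivity (curry (uncurry f)).
    + f_equal. cart. rewrite <- pairing_cmp, pairing_pr. cart. reflexivity.
    + apply curry_uncurry.
Qed.
Next Obligation.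
  rename Y0 into V.
  set (G := uncurry g ∘ beta W' Y V).
  transitivity (curry (aext G ∘ pmap (idm (W' × Y)) (ext TT f)
    ∘ assoc (W' × Y) W (T TT X) ∘ pmap (beta W' W Y) (idm (T TT X))
    ∘ beta (W' × W) (T TT X) Y)).
  - f_equal. f_equal.
    rewrite <- aext_ext, aext_nat. f_equal.
    rewrite !uncurry_cmp, uncurry_curry. cart. reflexivity.
  - rewrite !curry_cmp. f_equal. cart. reflexivity.
Qed.

End Power.

Record Model := {
  model_cat :> CartesianClosedCategory;
  two : Coproduct (@one model_cat) one;
  monad : StrongMonad model_cat
}.
Arguments two m : clear implicits.
Arguments monad m : clear implicits.

Inductive vty : Type :=
| vunit : vty
| vprod : vty -> vty -> vty
| vbool : vty
| U : cty -> vty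
with cty : Type :=
| cprod : cty -> cty -> cty
| arr : vty -> cty -> cty
| F : vty -> cty.

(* The head of a context is its most recently bound variable. *)
Inductive var (ty : Type) : list ty -> ty -> Type :=
| vz : forall G A, var (A :: G) A
| vs : forall G A B, var G A -> var (B :: G) A.
Arguments vz {ty G A}.
Arguments vs {ty G A B} x.

(* The body of match_, which binds (x1, x2), lives in A2 :: A1 :: G. *)
Inductive val : list vty -> vty -> Type :=
| vvar : forall G A, var G A -> val G A
| tt_ : forall G, val G vunit
| vpair : forall G A1 A2, val G A1 -> val G A2 -> val G (vprod A1 A2)
| vtrue : forall G, val G vbool
| vfalse : forall G, val G vbool
| thunk : forall G C, comp G C -> val G (U C)
with comp : list vty -> cty -> Type :=
| cpair : forall G C1 C2, comp G C1 -> comp G C2 -> comp G (cprod C1 C2)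
| cproj1 : forall G C1 C2, comp G (cprod C1 C2) -> comp G C1
| cproj2 : forall G C1 C2, comp G (cprod C1 C2) -> comp G C2
| lam : forall G A C, comp (A :: G) C -> comp G (arr A C)
| app : forall G A C, val G A -> comp G (arr A C) -> comp G C
| ret : forall G A, val G A -> comp G (F A)
| to_ : forall G A C, comp G (F A) -> comp (A :: G) C -> comp G C
| match_ : forall G A1 A2 C,
    val G (vprod A1 A2) -> comp (A2 :: A1 :: G) C -> comp G C
| if_ : forall G C, val G vbool -> comp G C -> comp G C -> comp G C
| force : forall G C, val G (U C) -> comp G C.
Arguments tt_ {G}.
Arguments vtrue {G}.
Arguments vfalse {G}.

Definition ren (ty : Type) (G D : list ty) : Type := forall A, var G A -> var D A.

Definition ren_up (ty : Type) (G D : list ty) (r : ren G D) (B : ty) :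
    ren (B :: G) (B :: D) :=
  fun A x =>
    match x in var G' A' return
      (match G' return Type with [] => Empty_set | _ :: G0 => ren G0 D end) ->
      var (match G' with [] => [] | B' :: _ => B' :: D end) A'
    with
    | vz => fun _ => vz
    | vs y => fun r => vs (r _ y)
    end r.
Arguments ren_up {ty G D} r {B} A x.

Fixpoint vren G A (V : val G A) : forall D, ren G D -> val D A :=
  match V in val G A return forall D, ren G D -> val D A with
  | vvar x => fun D r => vvar (r _ x)
  | tt_ => fun D r => tt_
  | vpair V1 V2 => fun D r => vpair (vren V1 r) (vren V2 r)
  | vtrue => fun D r => vtrue
  | vfalse => fun D r => vfalse
  | thunk M => fun D r => thunk (cren M r)
  end
with cren G C (M : comp G C) : forall D, ren G D -> comp D C :=
  match M in comp G C return forall D, ren G D -> comp D C with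
  | cpair M1 M2 => fun D r => cpair (cren M1 r) (cren M2 r)
  | cproj1 M => fun D r => cproj1 (cren M r)
  | cproj2 M => fun D r => cproj2 (cren M r)
  | lam M => fun D r => lam (cren M (ren_up r))
  | app V M => fun D r => app (vren V r) (cren M r)
  | ret V => fun D r => ret (vren V r)
  | to_ M N => fun D r => to_ (cren M r) (cren N (ren_up r))
  | match_ V M => fun D r => match_ (vren V r) (cren M (ren_up (ren_up r)))
  | if_ V M1 M2 => fun D r => if_ (vren V r) (cren M1 r) (cren M2 r)
  | force V => fun D r => force (vren V r)
  end.

Definition vwk G A B (V : val G A) : val (B :: G) A := vren V (fun _ x => vs x).
Definition cwk G C B (M : comp G C) : comp (B :: G) C := cren M (fun _ x => vs x).

Definition sub (G D : list vty) : Type := forall A, var G A -> val D A.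

Definition sub_up G D (s : sub G D) B : sub (B :: G) (B :: D) :=
  fun A x =>
    match x in var G' A' return
      (match G' return Type with [] => Empty_set | _ :: G0 => sub G0 D end) ->
      val (match G' with [] => [] | B' :: _ => B' :: D end) A'
    with
    | vz => fun _ => vvar vz
    | vs y => fun s => vwk _ (s _ y)
    end s.
Arguments sub_up {G D} s {B} A x.

Fixpoint vsub G A (V : val G A) : forall D, sub G D -> val D A :=
  match V in val G A return forall D, sub G D -> val D A with
  | vvar x => fun D s => s _ x
  | tt_ => fun D s => tt_
  | vpair V1 V2 => fun D s => vpair (vsub V1 s) (vsub V2 s)
  | vtrue => fun D s => vtrue
  | vfalse => fun D s => vfalse
  | thunk M => fun D s => thunk (csub M s)
  end
with csub G C (M : comp G C) : forall D, sub G D -> comp D C :=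
  match M in comp G C return forall D, sub G D -> comp D C with
  | cpair M1 M2 => fun D s => cpair (csub M1 s) (csub M2 s)
  | cproj1 M => fun D s => cproj1 (csub M s)
  | cproj2 M => fun D s => cproj2 (csub M s)
  | lam M => fun D s => lam (csub M (sub_up s))
  | app V M => fun D s => app (vsub V s) (csub M s)
  | ret V => fun D s => ret (vsub V s)
  | to_ M N => fun D s => to_ (csub M s) (csub N (sub_up s))
  | match_ V M => fun D s => match_ (vsub V s) (csub M (sub_up (sub_up s)))
  | if_ V M1 M2 => fun D s => if_ (vsub V s) (csub M1 s) (csub M2 s)
  | force V => fun D s => force (vsub V s)
  end.

Section Interpretation.
Variable M : Model.

Fixpoint ivty (A : vty) : M :=
  match A with
  | vunit => one
  | vprod A1 A2 => ivty A1 × ivty A2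
  | vbool => two M
  | U C => carrier (icty C)
  end
with icty (C : cty) : Algebra (monad M) :=
  match C with
  | cprod C1 C2 => prod_alg (icty C1) (icty C2)
  | arr A C => power_alg (ivty A) (icty C)
  | F A => free_alg (monad M) (ivty A)
  end.

Fixpoint ictx (G : list vty) : M :=
  match G with
  | [] => one
  | A :: G => ictx G × ivty A
  end.

Fixpoint ivar G A (x : var G A) : Hom (ictx G) (ivty A) :=
  match x in var G A return Hom (ictx G) (ivty A) with
  | vz => pr2
  | vs y => ivar y ∘ pr1
  end.

Fixpoint ival G A (V : val G A) : Hom (ictx G) (ivty A) :=
  match V in val G A return Hom (ictx G) (ivty A) with
  | vvar x => ivar x
  | tt_ => bang _
  | vpair V1 V2 => ⟨ival V1, ival V2⟩
  | vtrue => inl (two M) ∘ bang _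
  | vfalse => inr (two M) ∘ bang _
  | thunk N => icomp N
  end
with icomp G C (N : comp G C) : Hom (ictx G) (carrier (icty C)) :=
  match N in comp G C return Hom (ictx G) (carrier (icty C)) with
  | cpair N1 N2 => ⟨icomp N1, icomp N2⟩
  | cproj1 N => pr1 ∘ icomp N
  | cproj2 N => pr2 ∘ icomp N
  | lam N => curry (icomp N)
  | app V N => uncurry (icomp N) ∘ ⟨idm _, ival V⟩
  | ret V => eta (monad M) _ ∘ ival V
  | to_ N P => aext (icomp P) ∘ ⟨idm _, icomp N⟩
  | match_ V N => icomp N ∘ assoc_inv _ _ _ ∘ ⟨idm _, ival V⟩
  | if_ V N1 N2 =>
      copair (double (two M) _) (icomp N1) (icomp N2)
        ∘ dist (two M) _ ∘ ⟨idm _, ival V⟩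
  | force V => ival V
  end.

End Interpretation.

Definition program : Type := comp [] (F vbool).

Definition injective_ren (ty : Type) (G D : list ty) (r : ren G D) : Prop :=
  forall A (x y : var G A), r A x = r A y -> x = y.

(* cctx G0 C0 G C : computations G |- _ : C with one hole for computations
   G0 |- _ : C0.  Where the hole occurs, the variables of G0 are captured by
   distinct variables of the local scope D of the same types; D may contain
   further variables and list those of G0 in another order.  The renaming r
   records which variable of D captures each variable of G0. *)
Inductive vctx (G0 : list vty) (C0 : cty) : list vty -> vty -> Type :=
| xvpair1 : forall G A1 A2,
    vctx G0 C0 G A1 -> val G A2 -> vctx G0 C0 G (vprod A1 A2)
| xvpair2 : forall G A1 A2,
    val G A1 -> vctx G0 C0 G A2 -> vctx G0 C0 G (vprod A1 A2)
| xthunk : forall G C, cctx G0 C0 G C -> vctx G0 C0 G (U C)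
with cctx (G0 : list vty) (C0 : cty) : list vty -> cty -> Type :=
| xhole : forall D (r : ren G0 D), injective_ren r -> cctx G0 C0 D C0
| xcpair1 : forall G C1 C2,
    cctx G0 C0 G C1 -> comp G C2 -> cctx G0 C0 G (cprod C1 C2)
| xcpair2 : forall G C1 C2,
    comp G C1 -> cctx G0 C0 G C2 -> cctx G0 C0 G (cprod C1 C2)
| xcproj1 : forall G C1 C2, cctx G0 C0 G (cprod C1 C2) -> cctx G0 C0 G C1
| xcproj2 : forall G C1 C2, cctx G0 C0 G (cprod C1 C2) -> cctx G0 C0 G C2
| xlam : forall G A C, cctx G0 C0 (A :: G) C -> cctx G0 C0 G (arr A C)
| xapp1 : forall G A C, vctx G0 C0 G A -> comp G (arr A C) -> cctx G0 C0 G C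
| xapp2 : forall G A C, val G A -> cctx G0 C0 G (arr A C) -> cctx G0 C0 G C
| xret : forall G A, vctx G0 C0 G A -> cctx G0 C0 G (F A)
| xto1 : forall G A C,
    cctx G0 C0 G (F A) -> comp (A :: G) C -> cctx G0 C0 G C
| xto2 : forall G A C,
    comp G (F A) -> cctx G0 C0 (A :: G) C -> cctx G0 C0 G C
| xmatch1 : forall G A1 A2 C,
    vctx G0 C0 G (vprod A1 A2) -> comp (A2 :: A1 :: G) C -> cctx G0 C0 G C
| xmatch2 : forall G A1 A2 C,
    val G (vprod A1 A2) -> cctx G0 C0 (A2 :: A1 :: G) C -> cctx G0 C0 G C
| xif0 : forall G C,
    vctx G0 C0 G vbool -> comp G C -> comp G C -> cctx G0 C0 G C
| xif1 : forall G C,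
    val G vbool -> cctx G0 C0 G C -> comp G C -> cctx G0 C0 G C
| xif2 : forall G C,
    val G vbool -> comp G C -> cctx G0 C0 G C -> cctx G0 C0 G C
| xforce : forall G C, vctx G0 C0 G (U C) -> cctx G0 C0 G C.

Arguments xhole {G0 C0 D} r _.

Fixpoint vfill G0 C0 (M : comp G0 C0) G A (E : vctx G0 C0 G A) : val G A :=
  match E in vctx _ _ G A return val G A with
  | xvpair1 E V => vpair (vfill M E) V
  | xvpair2 V E => vpair V (vfill M E)
  | xthunk E => thunk (cfill M E)
  end
with cfill G0 C0 (M : comp G0 C0) G C (E : cctx G0 C0 G C) : comp G C :=
  match E in cctx _ _ G C return comp G C with
  | xhole r _ => cren M r
  | xcpair1 E N => cpair (cfill M E) N
  | xcpair2 N E => cpair N (cfill M E)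
  | xcproj1 E => cproj1 (cfill M E)
  | xcproj2 E => cproj2 (cfill M E)
  | xlam E => lam (cfill M E)
  | xapp1 E N => app (vfill M E) N
  | xapp2 V E => app V (cfill M E)
  | xret E => ret (vfill M E)
  | xto1 E N => to_ (cfill M E) N
  | xto2 N E => to_ N (cfill M E)
  | xmatch1 E N => match_ (vfill M E) N
  | xmatch2 V E => match_ V (cfill M E)
  | xif0 E N1 N2 => if_ (vfill M E) N1 N2
  | xif1 V E N => if_ V (cfill M E) N
  | xif2 V N E => if_ V N (cfill M E)
  | xforce E => force (vfill M E)
  end.

Definition ctx_le (R : program -> program -> Prop) G C (M M' : comp G C) : Prop :=
  forall E : cctx G C [] (F vbool), R (cfill M E) (cfill M' E).

Definition adequate (Mod : Model) (R : program -> program -> Prop) : Prop :=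
  forall G C (M M' : comp G C), icomp Mod M ⊑ icomp Mod M' -> ctx_le R M M'.

Inductive sty : Type :=
| sunit : sty
| sbool : sty
| sprod : sty -> sty -> sty
| sarr : sty -> sty -> sty.

Inductive expr : list sty -> sty -> Type :=
| evar : forall G t, var G t -> expr G t
| eunit : forall G, expr G sunit
| epair : forall G t1 t2, expr G t1 -> expr G t2 -> expr G (sprod t1 t2)
| efst : forall G t1 t2, expr G (sprod t1 t2) -> expr G t1
| esnd : forall G t1 t2, expr G (sprod t1 t2) -> expr G t2
| etrue : forall G, expr G sbool
| efalse : forall G, expr G sbool
| eif : forall G t, expr G sbool -> expr G t -> expr G t -> expr G t
| elam : forall G t t', expr (t :: G) t' -> expr G (sarr t t')
| eapp : forall G t t', expr G (sarr t t') -> expr G t -> expr G t'.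

Fixpoint var_map (ty ty' : Type) (f : ty -> ty') G t (x : var G t) :
    var (map f G) (f t) :=
  match x in var G t return var (map f G) (f t) with
  | vz => vz
  | vs y => vs (var_map f y)
  end.

Fixpoint var_map_case (ty ty' : Type) (f : ty -> ty') (P : ty' -> Type) (G : list ty) :
    (forall t, var G t -> P (f t)) -> forall A, var (map f G) A -> P A :=
  match G return
    (forall t, var G t -> P (f t)) -> forall A, var (map f G) A -> P A with
  | [] => fun _ A x =>
      match x in var D A return match D with [] => P A | _ :: _ => unit end with
      | vz => tt
      | vs _ => tt
      end
  | t :: G => fun h A x =>
      match x in var D A return
        match D with
        | [] => unit
        | B :: D => P B -> (forall A, var D A -> P A) -> P A
        end
      with
      | vz => fun p _ => p
      | vs y => fun _ q => q _ y
      end (h t vz) (var_map_case (fun t' y => h t' (vs y)))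
  end.

Lemma var_map_case_map (ty ty' : Type) (f : ty -> ty') (P : ty' -> Type) G
    (h : forall t, var G t -> P (f t)) t (x : var G t) :
  var_map_case h (var_map f x) = h t x.
Proof.
  revert h. induction x as [G t | G t u x IH]; intro h; [reflexivity|].
  apply (IH (fun t' y => h t' (vs y))).
Qed.

Fixpoint cbv_ty (t : sty) : vty :=
  match t with
  | sunit => vunit
  | sbool => vbool
  | sprod t1 t2 => vprod (cbv_ty t1) (cbv_ty t2)
  | sarr t t' => U (arr (cbv_ty t) (F (cbv_ty t')))
  end.

Definition cbv_ctx (G : list sty) : list vty := map cbv_ty G.

Fixpoint cbv G t (e : expr G t) : comp (cbv_ctx G) (F (cbv_ty t)) :=
  match e in expr G t return comp (cbv_ctx G) (F (cbv_ty t)) with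
  | evar x => ret (vvar (var_map cbv_ty x))
  | eunit _ => ret tt_
  | epair e1 e2 =>
      to_ (cbv e1) (to_ (cwk _ (cbv e2)) (ret (vpair (vvar (vs vz)) (vvar vz))))
  | efst e => to_ (cbv e) (match_ (vvar vz) (ret (vvar (vs vz))))
  | esnd e => to_ (cbv e) (match_ (vvar vz) (ret (vvar vz)))
  | etrue _ => ret vtrue
  | efalse _ => ret vfalse
  | eif e0 e1 e2 =>
      to_ (cbv e0) (if_ (vvar vz) (cwk _ (cbv e1)) (cwk _ (cbv e2)))
  | elam e => ret (thunk (lam (cbv e)))
  | eapp e e' =>
      to_ (cbv e) (to_ (cwk _ (cbv e')) (app (vvar vz) (force (vvar (vs vz)))))
  end.

Fixpoint cbn_ty (t : sty) : cty :=
  match t with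
  | sunit => F vunit
  | sbool => F vbool
  | sprod t1 t2 => cprod (cbn_ty t1) (cbn_ty t2)
  | sarr t t' => arr (U (cbn_ty t)) (cbn_ty t')
  end.

Definition cbn_ctx (G : list sty) : list vty := map (fun t => U (cbn_ty t)) G.

Fixpoint cbn G t (e : expr G t) : comp (cbn_ctx G) (cbn_ty t) :=
  match e in expr G t return comp (cbn_ctx G) (cbn_ty t) with
  | evar x => force (vvar (var_map (fun t => U (cbn_ty t)) x))
  | eunit _ => ret tt_
  | epair e1 e2 => cpair (cbn e1) (cbn e2)
  | efst e => cproj1 (cbn e)
  | esnd e => cproj2 (cbn e)
  | etrue _ => ret vtrue
  | efalse _ => ret vfalse
  | eif e0 e1 e2 =>
      to_ (cbn e0) (if_ (vvar vz) (cwk _ (cbn e1)) (cwk _ (cbn e2)))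
  | elam e => lam (cbn e)
  | eapp e e' => app (thunk (cbn e')) (cbn e)
  end.

Unset Implicit Arguments.

Fixpoint Phi (t : sty) : forall G, comp G (F (cbv_ty t)) -> comp G (cbn_ty t) :=
  match t return forall G, comp G (F (cbv_ty t)) -> comp G (cbn_ty t) with
  | sunit => fun G M => M
  | sbool => fun G M => M
  | sprod t1 t2 => fun G M =>
      cpair
        (to_ M (match_ (vvar vz) (Phi t1 _ (ret (vvar (vs vz))))))
        (to_ M (match_ (vvar vz) (Phi t2 _ (ret (vvar vz)))))
  | sarr t t' => fun G M =>
      lam (to_ (cwk _ M)
        (to_ (Psi t _ (force (vvar (vs vz))))
          (Phi t' _ (app (vvar vz) (force (vvar (vs vz)))))))
  end
with Psi (t : sty) : forall G, comp G (cbn_ty t) -> comp G (F (cbv_ty t)) :=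
  match t return forall G, comp G (cbn_ty t) -> comp G (F (cbv_ty t)) with
  | sunit => fun G N => N
  | sbool => fun G N => N
  | sprod t1 t2 => fun G N =>
      to_ (Psi t1 _ (cproj1 N))
        (to_ (Psi t2 _ (cproj2 (cwk _ N)))
          (ret (vpair (vvar (vs vz)) (vvar vz))))
  | sarr t t' => fun G N =>
      ret (thunk (lam
        (Psi t' _ (app (thunk (Phi t _ (ret (vvar vz)))) (cwk _ N)))))
  end.
Arguments Phi t {G} M.
Arguments Psi t {G} N.

Set Implicit Arguments.

Definition Phi_hat (G : list sty) : sub (cbn_ctx G) (cbv_ctx G) :=
  var_map_case (P := val (cbv_ctx G))
    (fun t x => thunk (Phi t (ret (vvar (var_map cbv_ty x))))).
Arguments Phi_hat : clear implicits.

(* Main.v *)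
(* Each map Phi, Psi acts on denotations by composition with a morphism phi, psi
   between T[[V t]] and the carrier of [[N t]].  Lax idempotency says that every
   morphism h between algebras is a lax homomorphism: running m first and then h
   is below applying h to the unevaluated m.  Hence id ⊑ psi ∘ phi (a map out of
   T X lying above eta on eta lies above the identity) and phi ∘ psi ⊑ id, by
   induction on types.  An induction on e gives [[V(e)]] ⊑ psi ∘ [[N(e)[Phi]]],
   pushing psi ∘ phi under the evaluation of subterms, and adequacy concludes. *)
Require Import Defs.
From Stdlib Require Import List Relations.Relation_Definitions.
Import ListNotations.
Set Implicit Arguments.
Unset Strict Implicit.
Unset Printing Implicit Defensive.
Local Open Scope cat_scope.

(** * Sequencing in algebras over a strong monad *)

Section Bind.
Variables (C : CartesianCategory) (TT : StrongMonad C).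
Implicit Types V W X Y : C.
Implicit Types Z : Algebra TT.

Lemma hle_refl X Y (f : Hom X Y) : f ⊑ f.
Proof. apply hle_order. Qed.

Lemma hle_trans X Y (f g h : Hom X Y) : f ⊑ g -> g ⊑ h -> f ⊑ h.
Proof. apply (ord_trans _ _ (hle_order X Y)). Qed.

Lemma eq_hle X Y (f g : Hom X Y) : f = g -> f ⊑ g.
Proof. intros ->. apply hle_refl. Qed.

(** This is the interpretation of [to_], over an arbitrary context [W] and into an arbitrary
    algebra. *)
Definition bind Z W X (m : Hom W (T TT X)) (k : Hom (W × X) (carrier Z)) :
    Hom W (carrier Z) :=
  aext k ∘ ⟨idm W, m⟩.

Lemma bind_mono Z W X (m m' : Hom W (T TT X)) (k k' : Hom (W × X) (carrier Z)) :
  m ⊑ m' -> k ⊑ k' -> bind m k ⊑ bind m' k'.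
Proof.
  intros Hm Hk. apply cmp_mono; [apply aext_mono, Hk|].
  apply pairing_mono; [apply hle_refl | exact Hm].
Qed.

Lemma aext_pairing Z V W X (k : Hom (W × X) (carrier Z)) (w : Hom V W)
    (m : Hom V (T TT X)) :
  aext k ∘ ⟨w, m⟩ = bind m (k ∘ pmap w (idm X)).
Proof. unfold bind. rewrite <- aext_nat. cart. reflexivity. Qed.

Lemma bind_cmp Z V W X (m : Hom W (T TT X)) (k : Hom (W × X) (carrier Z))
    (w : Hom V W) :
  bind m k ∘ w = bind (m ∘ w) (k ∘ pmap w (idm X)).
Proof. rewrite <- aext_pairing. unfold bind. cart. reflexivity. Qed.

(** Restates [bind_cmp] with [T TT Y] in place of the convertible [carrier (free_alg TT Y)], so that
    [rewrite] finds composites of that form. *)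
Lemma bind_cmp_free V W X Y (m : Hom W (T TT X)) (k : Hom (W × X) (T TT Y))
    (w : Hom V W) :
  (bind (Z := free_alg TT Y) m k : Hom W (T TT Y)) ∘ w
  = bind (Z := free_alg TT Y) (m ∘ w) (k ∘ pmap w (idm X)).
Proof. apply (bind_cmp (Z := free_alg TT Y)). Qed.

Lemma bind_eta Z W X (v : Hom W X) (k : Hom (W × X) (carrier Z)) :
  bind (eta TT X ∘ v) k = k ∘ ⟨idm W, v⟩.
Proof. unfold bind. rewrite <- (aext_eta k) at 2. cart. reflexivity. Qed.

(** [ext_unit] speaks only of the context [one]; a continuation that ignores [W] is pulled back from
    [one] along [bang W]. *)
Lemma bind_ret W X (m : Hom W (T TT X)) :
  bind (Z := free_alg TT X) m (eta TT X ∘ pr2) = m.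
Proof.
  transitivity (aext (a := free_alg TT X) (eta TT X ∘ @pr2 C one X) ∘ ⟨bang W, m⟩).
  - rewrite aext_pairing. f_equal. cart. reflexivity.
  - cbn. rewrite ext_unit. cart. reflexivity.
Qed.

(** [aext_ext] keeps two contexts apart; here both are [W], merged by pulling back along the
    diagonal [⟨idm W, idm W⟩]. *)
Lemma bind_assoc Z W X Y (m : Hom W (T TT X)) (k : Hom (W × X) (T TT Y))
    (l : Hom (W × Y) (carrier Z)) :
  bind (bind (Z := free_alg TT Y) m k) l = bind m (bind k (l ∘ pmap pr1 (idm Y))).
Proof.
  transitivity (aext (aext l ∘ pmap (idm W) k ∘ assoc W W X)
    ∘ pmap ⟨idm W, idm W⟩ (idm _) ∘ ⟨idm W, m⟩).
  - rewrite aext_ext. unfold bind. cbn. cart. reflexivity.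
  - rewrite aext_nat. unfold bind at 1. do 2 f_equal.
    rewrite <- aext_pairing. cart. reflexivity.
Qed.

(** * Lax homomorphisms over a lax idempotent monad *)

Section Lax.
Hypothesis Hlax : lax_idempotent TT.

(* Both sides factor through [aext k : W × TTX -> Z]: precomposing it with
   [T eta] gives the left side, and with [eta] the right one. *)
Lemma aext_lax Z W X (k : Hom (W × T TT X) (carrier Z)) :
  aext (k ∘ pmap (idm W) (eta TT X)) ⊑ k.
Proof.
  rewrite <- (aext_eta k) at 2.
  apply hle_trans with (aext k ∘ pmap (idm W) (Tmap TT (eta TT X))).
  - apply eq_hle.
    (* [Tmap] extends over the context [one], so [⟨⟨pr1, bang _⟩, pr2⟩] inserts a dummy factor to
       make [aext_ext] applicable. *)
    transitivity (aext k ∘ pmap (idm W) (ext TT (eta TT _ ∘ eta TT X ∘ @pr2 C one X))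
      ∘ assoc W one (T TT X) ∘ ⟨⟨pr1, bang _⟩, pr2⟩).
    + rewrite <- aext_ext.
      transitivity (aext (k ∘ pmap (idm W) (eta TT X)) ∘ pmap pr1 (idm _)
        ∘ ⟨⟨pr1, bang (W × T TT X)⟩, pr2⟩).
      * cart. reflexivity.
      * rewrite aext_nat. do 2 f_equal. rewrite <- (aext_eta k) at 1. cart. reflexivity.
    + unfold Tmap, kleisli. cart. rewrite (bang_uniq (bang (T TT X) ∘ pr2)). reflexivity.
  - apply cmp_mono; [apply hle_refl|]. apply pairing_mono; [apply hle_refl|].
    apply cmp_mono; [apply Hlax | apply hle_refl].
Qed.

Lemma bind_lax Z W X (m : Hom W (T TT X)) (k : Hom (W × T TT X) (carrier Z)) :
  bind m (k ∘ pmap (idm W) (eta TT X)) ⊑ k ∘ ⟨idm W, m⟩.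
Proof. apply cmp_mono; [apply aext_lax | apply hle_refl]. Qed.

(** Apply [bind_lax] to [h ∘ aext k], whose restriction along [eta] is [h ∘ k]. *)
Lemma bind_cmp_lax Z Z' W X (m : Hom W (T TT X)) (k : Hom (W × X) (carrier Z))
    (h : Hom (carrier Z) (carrier Z')) :
  bind m (h ∘ k) ⊑ h ∘ bind m k.
Proof.
  unfold bind at 2. rewrite cmp_assoc, <- (aext_eta k) at 1. rewrite cmp_assoc.
  apply bind_lax.
Qed.

Lemma bind_eta_lax Z W X (m : Hom W (T TT X)) (h : Hom (T TT X) (carrier Z)) :
  bind m (h ∘ eta TT X ∘ pr2) ⊑ h ∘ m.
Proof.
  apply hle_trans with (h ∘ bind (Z := free_alg TT X) m (eta TT X ∘ pr2)).
  - rewrite <- cmp_assoc. apply bind_cmp_lax with (Z := free_alg TT X).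
  - rewrite bind_ret. apply hle_refl.
Qed.

(** Effects can be discarded in the direction of [⊑]: [k ∘ pr1] also makes sense on [W × T TT X],
    where [bind_lax] applies to it. *)
Lemma bind_const_lax Z W X (m : Hom W (T TT X)) (k : Hom W (carrier Z)) :
  bind m (k ∘ pr1) ⊑ k.
Proof.
  apply hle_trans with (k ∘ pr1 ∘ ⟨idm W, m⟩).
  - eapply hle_trans; [|apply bind_lax]. apply eq_hle. f_equal. cart. reflexivity.
  - apply eq_hle. cart. reflexivity.
Qed.

(* [h] lies above the homomorphic extension of [h ∘ eta]. *)
Lemma hle_on_eta X (h : Hom (T TT X) (T TT X)) :
  eta TT X ⊑ h ∘ eta TT X -> idm _ ⊑ h.
Proof.
  intro H. rewrite <- (cmp_id_r h).
  eapply hle_trans; [|apply (bind_eta_lax (Z := free_alg TT X))].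
  rewrite <- (bind_ret (idm (T TT X))) at 1.
  apply (bind_mono (Z := free_alg TT X)); [apply hle_refl|].
  apply cmp_mono; [exact H | apply hle_refl].
Qed.

End Lax.

End Bind.

(** * Case analysis on the booleans *)

Section Split.
Variables (C : CartesianClosedCategory) (two : Coproduct (@one C) one).
Implicit Types V W X Y : C.

Lemma split_two_cmp V W X (f g : Hom W X) (w : Hom V W) :
  split_two two f g ∘ pmap w (idm two) = split_two two (f ∘ w) (g ∘ w).
Proof.
  rewrite (split_two_uniq (two := two) (split_two two f g ∘ _)). f_equal.
  - rewrite <- (split_two_pick1 two f g) at 2. unfold pick1. cart.
    rewrite <- cmp_assoc. rewrite (bang_uniq (bang W ∘ w)). reflexivity.
  - rewrite <- (split_two_pick2 two f g) at 2. unfold pick2. cart.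
    rewrite <- cmp_assoc. rewrite (bang_uniq (bang W ∘ w)). reflexivity.
Qed.

Lemma cmp_split_two W X Y (f g : Hom W X) (h : Hom X Y) :
  h ∘ split_two two f g = split_two two (h ∘ f) (h ∘ g).
Proof.
  rewrite (split_two_uniq (two := two) (h ∘ _)), <- !cmp_assoc,
    split_two_pick1, split_two_pick2.
  reflexivity.
Qed.

End Split.

(** * Adjoint pairs between free and arbitrary algebras *)

Section Reflection.
Variables (C : CartesianClosedCategory) (TT : StrongMonad C).
Hypothesis Hlax : lax_idempotent TT.
Implicit Types V W X Y : C.
Implicit Types Z : Algebra TT.

Lemma uncurry_pairing V W X Y (h : Hom W (X ⇒ Y)) (w : Hom V W) (x : Hom V X) :
  uncurry h ∘ ⟨w, x⟩ = ev ∘ ⟨h ∘ w, x⟩.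
Proof. unfold uncurry. cart. reflexivity. Qed.

Lemma ev_curry_pairing V W X Y (f : Hom (W × X) Y) (w : Hom V W) (x : Hom V X) :
  ev ∘ ⟨curry f ∘ w, x⟩ = f ∘ ⟨w, x⟩.
Proof. rewrite <- uncurry_pairing, uncurry_curry. reflexivity. Qed.

Lemma cmp_ev_curry_pairing U V W X Y (g : Hom Y U) (f : Hom (W × X) Y)
    (w : Hom V W) (x : Hom V X) :
  g ∘ ev ∘ ⟨curry f ∘ w, x⟩ = g ∘ f ∘ ⟨w, x⟩.
Proof. rewrite <- !cmp_assoc, ev_curry_pairing. reflexivity. Qed.

Lemma curry_ev X Y : curry (@ev C X Y) = idm _.
Proof.
  rewrite <- (curry_uncurry (idm (X ⇒ Y))). f_equal. unfold uncurry. cart. reflexivity.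
Qed.

(** With lax idempotency this makes [phi] left adjoint to [psi]. The unit is asked only at [eta],
    which is all that has to be checked at each type; [reflects_unit] recovers it in general. *)
Definition reflects X Z (phi : Hom (T TT X) (carrier Z))
    (psi : Hom (carrier Z) (T TT X)) : Prop :=
  eta TT X ⊑ psi ∘ phi ∘ eta TT X /\ phi ∘ psi ⊑ idm _.

Lemma reflects_unit X Z (phi : Hom (T TT X) (carrier Z))
    (psi : Hom (carrier Z) (T TT X)) :
  reflects phi psi -> forall W (m : Hom W (T TT X)), m ⊑ psi ∘ phi ∘ m.
Proof.
  intros [H _] W m. rewrite <- (cmp_id_l m) at 1.
  apply cmp_mono; [|apply hle_refl]. apply hle_on_eta; assumption.
Qed.

Lemma reflects_counit X Z (phi : Hom (T TT X) (carrier Z))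
    (psi : Hom (carrier Z) (T TT X)) :
  reflects phi psi -> forall W (n : Hom W (carrier Z)), phi ∘ psi ∘ n ⊑ n.
Proof.
  intros [_ H] W n. rewrite <- (cmp_id_l n) at 2.
  apply cmp_mono; [exact H | apply hle_refl].
Qed.

Section Constructors.
Variables (X1 X2 : C) (Z1 Z2 : Algebra TT).
Variables (phi1 : Hom (T TT X1) (carrier Z1)) (psi1 : Hom (carrier Z1) (T TT X1)).
Variables (phi2 : Hom (T TT X2) (carrier Z2)) (psi2 : Hom (carrier Z2) (T TT X2)).

(** This map and the next three are the clauses of [Phi] and [Psi] at product and function types,
    read at a generic argument: the context is the type of the computation being converted. *)
Definition phi_prod : Hom (T TT (X1 × X2)) (carrier Z1 × carrier Z2) :=
  ⟨bind (idm _) (phi1 ∘ eta TT X1 ∘ pr1 ∘ pr2),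
   bind (idm _) (phi2 ∘ eta TT X2 ∘ pr2 ∘ pr2)⟩.

Definition psi_prod : Hom (carrier Z1 × carrier Z2) (T TT (X1 × X2)) :=
  bind (Z := free_alg TT _) (psi1 ∘ pr1)
    (bind (Z := free_alg TT _) (psi2 ∘ pr2 ∘ pr1)
      (eta TT (X1 × X2) ∘ ⟨pr2 ∘ pr1, pr2⟩)).

Definition phi_arr : Hom (T TT (X1 ⇒ T TT X2)) (carrier Z1 ⇒ carrier Z2) :=
  curry (bind pr1 (bind (psi1 ∘ pr2 ∘ pr1) (phi2 ∘ ev ∘ ⟨pr2 ∘ pr1, pr2⟩))).

Definition psi_arr : Hom (carrier Z1 ⇒ carrier Z2) (T TT (X1 ⇒ T TT X2)) :=
  eta TT _ ∘ curry (psi2 ∘ ev ∘ ⟨pr1, phi1 ∘ eta TT X1 ∘ pr2⟩).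

Hypotheses (R1 : reflects phi1 psi1) (R2 : reflects phi2 psi2).

Lemma phi_prod_cmp W (m : Hom W (T TT (X1 × X2))) :
  phi_prod ∘ m = ⟨bind m (phi1 ∘ eta TT X1 ∘ pr1 ∘ pr2),
                  bind m (phi2 ∘ eta TT X2 ∘ pr2 ∘ pr2)⟩.
Proof.
  unfold phi_prod. rewrite pairing_cmp, !bind_cmp. f_equal; f_equal; cart; reflexivity.
Qed.

Lemma psi_prod_cmp W (n : Hom W (carrier Z1 × carrier Z2)) :
  psi_prod ∘ n =
  bind (Z := free_alg TT _) (psi1 ∘ pr1 ∘ n)
    (bind (Z := free_alg TT _) (psi2 ∘ pr2 ∘ n ∘ pr1)
      (eta TT (X1 × X2) ∘ ⟨pr2 ∘ pr1, pr2⟩)).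
Proof.
  unfold psi_prod. rewrite bind_cmp_free. f_equal.
  rewrite bind_cmp_free. f_equal; cart; reflexivity.
Qed.

Lemma reflects_prod : reflects (Z := prod_alg Z1 Z2) phi_prod psi_prod.
Proof.
  split.
  - rewrite <- cmp_assoc, psi_prod_cmp, phi_prod_cmp.
    rewrite <- (cmp_id_r (eta TT (X1 × X2))), !bind_eta.
    (* A returned pair makes both bindings in [phi_prod] trivial; [R1] and [R2] then bound
       [psi_prod] below by the program that rebuilds the pair. *)
    apply hle_trans with (bind (Z := free_alg TT (X1 × X2)) (eta TT X1 ∘ pr1)
      (bind (Z := free_alg TT (X1 × X2)) (eta TT X2 ∘ (pr2 ∘ pr1))
        (eta TT (X1 × X2) ∘ ⟨pr2 ∘ pr1, pr2⟩))).
    + apply eq_hle. rewrite !bind_eta. cart. reflexivity.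
    + apply (bind_mono (Z := free_alg TT _)).
      * cart. apply cmp_mono; [apply R1 | apply hle_refl].
      * apply (bind_mono (Z := free_alg TT _)); [|cart; apply hle_refl].
        cart. do 2 (apply cmp_mono; [|apply hle_refl]). apply R2.
  - change (phi_prod ∘ psi_prod ⊑ idm (carrier Z1 × carrier Z2)).
    rewrite phi_prod_cmp, <- pairing_pr. unfold psi_prod.
    (* In each component the evaluation of the other one is discarded by [bind_const_lax], and the
       counit removes the round trip on the component itself. *)
    apply pairing_mono; rewrite bind_assoc.
    + apply hle_trans with (bind (Z := Z1) (psi1 ∘ pr1) (phi1 ∘ eta TT X1 ∘ pr2)).
      * apply bind_mono; [apply hle_refl|].
        rewrite bind_assoc.
        eapply hle_trans; [|apply (bind_const_lax Hlax (psi2 ∘ pr2 ∘ pr1))].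
        apply eq_hle. f_equal. rewrite bind_eta. cart. reflexivity.
      * eapply hle_trans; [apply bind_eta_lax; assumption|].
        rewrite cmp_assoc. apply reflects_counit, R1.
    + apply hle_trans with (bind (Z := Z2) (psi1 ∘ pr1) (@pr2 C _ (carrier Z2) ∘ pr1)).
      * apply bind_mono; [apply hle_refl|].
        rewrite bind_assoc.
        eapply hle_trans; [|apply (reflects_counit R2)].
        eapply hle_trans; [|rewrite <- cmp_assoc; apply bind_eta_lax; assumption].
        apply eq_hle. f_equal; [cart; reflexivity|]. rewrite bind_eta. cart. reflexivity.
      * apply bind_const_lax, Hlax.
Qed.

Lemma phi_arr_cmp W (m : Hom W (T TT (X1 ⇒ T TT X2))) :
  phi_arr ∘ m =
  curry (bind (m ∘ pr1) (bind (psi1 ∘ pr2 ∘ pr1) (phi2 ∘ ev ∘ ⟨pr2 ∘ pr1, pr2⟩))).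
Proof.
  unfold phi_arr. rewrite curry_cmp. f_equal. rewrite bind_cmp. f_equal; [cart; reflexivity|].
  rewrite bind_cmp. f_equal; cart; reflexivity.
Qed.

Lemma psi_arr_cmp W (n : Hom W (carrier Z1 ⇒ carrier Z2)) :
  psi_arr ∘ n = eta TT _ ∘ curry (psi2 ∘ uncurry n ∘ ⟨pr1, phi1 ∘ eta TT X1 ∘ pr2⟩).
Proof.
  unfold psi_arr. rewrite <- cmp_assoc, curry_cmp. do 2 f_equal.
  unfold uncurry. cart. reflexivity.
Qed.

Lemma reflects_arr : reflects (Z := power_alg (carrier Z1) Z2) phi_arr psi_arr.
Proof.
  split.
  - rewrite <- cmp_assoc, psi_arr_cmp, phi_arr_cmp, uncurry_curry.
    rewrite <- (cmp_id_r (eta TT (_ ⇒ _))) at 1. rewrite <- curry_ev.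
    apply cmp_mono; [apply hle_refl|]. apply curry_mono.
    rewrite bind_eta, bind_cmp, <- cmp_assoc, bind_cmp.
    eapply hle_trans; [apply (reflects_unit R2)|]. rewrite <- cmp_assoc.
    apply cmp_mono; [apply hle_refl|].
    apply hle_trans with
      (bind (eta TT X1 ∘ pr2) (phi2 ∘ ev ∘ pmap (@pr1 C _ X1) (idm X1))).
    + apply eq_hle. rewrite bind_eta. cart. reflexivity.
    + apply bind_mono; [|cart; apply hle_refl].
      cart. apply cmp_mono; [apply R1 | apply hle_refl].
  - change (phi_arr ∘ psi_arr ⊑ idm (carrier Z1 ⇒ carrier Z2)).
    rewrite phi_arr_cmp, <- (curry_uncurry (idm (_ ⇒ _))). apply curry_mono.
    unfold psi_arr. rewrite <- cmp_assoc, bind_eta, bind_cmp.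
    (* The evaluated argument enters as [phi1 ∘ eta], a restriction along [eta], so [bind_lax] may
       replace it by the unevaluated [phi1 ∘ psi1 ∘ pr2]. *)
    apply hle_trans with (bind (psi1 ∘ pr2)
      (ev ∘ ⟨pr1 ∘ pr1, phi1 ∘ pr2⟩ ∘ pmap (idm _) (eta TT X1))).
    + apply bind_mono; [cart; apply hle_refl|].
      eapply hle_trans; [|apply (reflects_counit R2)].
      apply eq_hle. cart. rewrite <- !(cmp_assoc _ pr1), cmp_ev_curry_pairing.
      cart. reflexivity.
    + eapply hle_trans; [apply bind_lax; assumption|].
      apply hle_trans with (ev ∘ ⟨pr1, phi1 ∘ psi1 ∘ pr2⟩).
      { apply eq_hle. cart. reflexivity. }
      unfold uncurry, pmap. rewrite !cmp_id_l.
      apply cmp_mono; [apply hle_refl|]. apply pairing_mono; [apply hle_refl|].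
      apply reflects_counit, R1.
Qed.

End Constructors.
End Reflection.

(* Induction on terms and variables *)
Scheme val_comp_ind := Induction for val Sort Prop
  with comp_val_ind := Induction for comp Sort Prop.
Combined Scheme val_comp_mutind from val_comp_ind, comp_val_ind.

(** The motive matches on the context and takes [P] as an argument, because the type of [P] depends
    on the index [B :: G]. *)
Lemma var_cons_ind (ty : Type) (B : ty) (G : list ty)
    (P : forall A, var (B :: G) A -> Prop) :
  P B vz -> (forall A (x : var G A), P A (vs x)) -> forall A x, P A x.
Proof.
  intros H0 HS A x.
  refine (match x as y in var D A return
    match D return var D A -> Prop with
    | [] => fun _ => True
    | B :: G => fun y => forall P : forall A, var (B :: G) A -> Prop,
        P B vz -> (forall A x, P A (vs x)) -> P A y
    end y
  with vz => fun _ H0 _ => H0 | vs x => fun _ _ HS => HS _ x end P H0 HS).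
Qed.

(** [var_map f] reaches every variable of [map f G], so substitutions out of a translated context
    need checking only on translated variables. *)
Lemma var_map_ind (ty ty' : Type) (f : ty -> ty') (G : list ty)
    (P : forall A, var (map f G) A -> Prop) :
  (forall t (x : var G t), P _ (var_map f x)) -> forall A x, P A x.
Proof.
  revert P. induction G as [|t G IH]; intros P H A x.
  - exfalso. exact (match x in var D _ return match D with [] => False | _ => True end
      with vz => I | vs _ => I end).
  - revert A x. apply var_cons_ind; [exact (H _ vz)|].
    apply (IH (fun A x => P A (vs x))). intros u x. apply (H _ (vs x)).
Qed.

(** * Denotations under renaming and substitution *)

Section Semantics.
Variable M : Model.
Notation TT := (monad M).

Lemma icomp_cpair G C1 C2 (N1 : comp G C1) (N2 : comp G C2) :
  icomp M (cpair N1 N2) = ⟨icomp M N1, icomp M N2⟩.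
Proof. reflexivity. Qed.

Lemma icomp_lam G A C (N : comp (A :: G) C) : icomp M (lam N) = curry (icomp M N).
Proof. reflexivity. Qed.

Lemma icomp_ret G A (V : val G A) : icomp M (ret V) = eta TT _ ∘ ival M V.
Proof. reflexivity. Qed.

Lemma icomp_to G A C (N : comp G (F A)) (P : comp (A :: G) C) :
  icomp M (to_ N P) = bind (Z := icty M C) (icomp M N) (icomp M P).
Proof. reflexivity. Qed.

Lemma icomp_match G A1 A2 C (V : val G (vprod A1 A2)) (N : comp (A2 :: A1 :: G) C) :
  icomp M (match_ V N) = icomp M N ∘ ⟨⟨idm _, pr1 ∘ ival M V⟩, pr2 ∘ ival M V⟩.
Proof. cbn [icomp ictx ivty]. cart. reflexivity. Qed.

Lemma icomp_if G C (V : val G vbool) (N1 N2 : comp G C) :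
  icomp M (if_ V N1 N2)
  = split_two (two M) (icomp M N1) (icomp M N2) ∘ ⟨idm _, ival M V⟩.
Proof. cbn [icomp]. unfold dist. rewrite cmp_id_r. reflexivity. Qed.

Lemma icomp_app G A C (V : val G A) (N : comp G (arr A C)) :
  icomp M (Defs.app V N) = ev ∘ ⟨icomp M N, ival M V⟩.
Proof. cbn [icomp]. unfold uncurry. cart. reflexivity. Qed.

(** Common to renaming and substitution: every clause of the interpretation is natural in the
    context, and [up] carries the hypothesis on variables under a binder. *)
Ltac interp_cmp up :=
  match goal with
  | |- ival _ tt_ = _ => apply bang_eq
  | |- ival _ (vpair _ _) = _ => cbn [ival ivty]; rewrite pairing_cmp; f_equal; auto
  | |- ival _ vtrue = _ => cbn; rewrite <- cmp_assoc; f_equal; apply bang_eq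
  | |- ival _ vfalse = _ => cbn; rewrite <- cmp_assoc; f_equal; apply bang_eq
  | |- icomp _ (cpair _ _) = _ =>
      etransitivity; [|symmetry; apply pairing_cmp]; cbn; f_equal; auto
  | |- icomp _ (cproj1 _) = _ => cbn [icomp]; rewrite <- cmp_assoc; f_equal; auto
  | |- icomp _ (cproj2 _) = _ => cbn [icomp]; rewrite <- cmp_assoc; f_equal; auto
  | |- icomp _ (lam _) = _ =>
      etransitivity; [|symmetry; apply curry_cmp]; cbn; f_equal; auto using up
  | |- icomp _ (Defs.app _ _) = _ =>
      rewrite !icomp_app, <- cmp_assoc, pairing_cmp; f_equal; f_equal; auto
  | |- icomp _ (ret _) = _ => cbn [icomp]; rewrite <- cmp_assoc; f_equal; auto
  | |- icomp _ (to_ _ _) = _ => rewrite !icomp_to, bind_cmp; f_equal; auto using up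
  | IHV : context [ival _ ?V], IHN : context [icomp _ ?N], H : _
    |- _ = icomp _ (match_ ?V ?N) ∘ ?w =>
      rewrite !icomp_match, (IHV _ _ _ H), (IHN _ _ _ (up _ _ _ _ _ (up _ _ _ _ _ H)));
      cbn [ictx ivty]; cart; reflexivity
  | IHV : context [ival _ ?V], IH1 : context [icomp _ ?N1],
    IH2 : context [icomp _ ?N2], H : _
    |- _ = icomp _ (if_ ?V ?N1 ?N2) ∘ ?w =>
      rewrite !icomp_if, (IHV _ _ _ H), (IH1 _ _ _ H), (IH2 _ _ _ H), <- split_two_cmp;
      cart; reflexivity
  | |- _ => cbn; auto
  end.

(** The morphism [w] is any one that agrees with [r] on variables, so binders can use
    [pmap w (idm _)] and weakening can use [pr1]. *)
Lemma ren_sem :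
  (forall G A (V : val G A) D (r : ren G D) (w : Hom (ictx M D) (ictx M G)),
    (forall B x, ivar M (r B x) = ivar M x ∘ w) ->
    ival M (vren V r) = ival M V ∘ w) /\
  (forall G C (N : comp G C) D (r : ren G D) (w : Hom (ictx M D) (ictx M G)),
    (forall B x, ivar M (r B x) = ivar M x ∘ w) ->
    icomp M (cren N r) = icomp M N ∘ w).
Proof.
  assert (up : forall G D (r : ren G D) (w : Hom (ictx M D) (ictx M G)) A,
    (forall B x, ivar M (r B x) = ivar M x ∘ w) ->
    forall B x, ivar M (ren_up r (B := A) B x)
      = ivar M x ∘ (pmap w (idm (ivty M A)) : Hom (ictx M (A :: D)) (ictx M (A :: G)))).
  { intros G D r w A H. apply var_cons_ind; [cbn; cart; reflexivity|].
    intros B x. cbn. rewrite H. cart. reflexivity. }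
  apply val_comp_mutind; intros; cbn [vren cren]; interp_cmp up.
Qed.

Lemma ival_vwk G A B (V : val G A) : ival M (vwk B V) = ival M V ∘ pr1.
Proof. apply ren_sem. reflexivity. Qed.

Lemma icomp_cwk G C B (N : comp G C) : icomp M (cwk B N) = icomp M N ∘ pr1.
Proof. apply ren_sem. reflexivity. Qed.

Lemma sub_sem :
  (forall G A (V : val G A) D (s : sub G D) (w : Hom (ictx M D) (ictx M G)),
    (forall B x, ival M (s B x) = ivar M x ∘ w) ->
    ival M (vsub V s) = ival M V ∘ w) /\
  (forall G C (N : comp G C) D (s : sub G D) (w : Hom (ictx M D) (ictx M G)),
    (forall B x, ival M (s B x) = ivar M x ∘ w) ->
    icomp M (csub N s) = icomp M N ∘ w).
Proof.
  assert (up : forall G D (s : sub G D) (w : Hom (ictx M D) (ictx M G)) A,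
    (forall B x, ival M (s B x) = ivar M x ∘ w) ->
    forall B x, ival M (sub_up s (B := A) B x)
      = ivar M x ∘ (pmap w (idm (ivty M A)) : Hom (ictx M (A :: D)) (ictx M (A :: G)))).
  { intros G D s w A H. apply var_cons_ind; [cbn; cart; reflexivity|].
    intros B x. cbn [sub_up]. rewrite ival_vwk, H. cbn. cart. reflexivity. }
  apply val_comp_mutind; intros; cbn [vsub csub]; interp_cmp up.
Qed.

(** * Denotations of the conversions between evaluation orders *)

Fixpoint phi (t : sty) : Hom (T TT (ivty M (cbv_ty t))) (carrier (icty M (cbn_ty t))) :=
  match t with
  | sunit => idm (T TT one)
  | sbool => idm (T TT (two M))
  | sprod t1 t2 => phi_prod (phi t1) (phi t2)
  | sarr t t' => phi_arr (psi t) (phi t')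
  end
with psi (t : sty) : Hom (carrier (icty M (cbn_ty t))) (T TT (ivty M (cbv_ty t))) :=
  match t with
  | sunit => idm (T TT one)
  | sbool => idm (T TT (two M))
  | sprod t1 t2 => psi_prod (psi t1) (psi t2)
  | sarr t t' => psi_arr (phi t) (psi t')
  end.

Lemma reflects_id X : reflects (Z := free_alg TT X) (idm (T TT X)) (idm (T TT X)).
Proof. split; apply eq_hle; rewrite ?cmp_id_l; reflexivity. Qed.

Lemma reflects_phi_psi (Hlax : lax_idempotent TT) t : reflects (phi t) (psi t).
Proof.
  induction t.
  - apply reflects_id.
  - apply reflects_id.
  - apply reflects_prod; assumption.
  - apply reflects_arr; assumption.
Qed.

(** One induction serves both halves, since at function types each conversion calls the other. The
    [change] steps expose one level of the fixpoints so that the [_cmp] lemmas apply. *)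
Lemma Phi_Psi_sem t :
  (forall G (N : comp G (F (cbv_ty t))), icomp M (Phi t N) = phi t ∘ icomp M N) /\
  (forall G (N : comp G (cbn_ty t)), icomp M (Psi t N) = psi t ∘ icomp M N).
Proof.
  induction t as [| |t1 [Phi1 Psi1] t2 [Phi2 Psi2]|t1 [Phi1 Psi1] t2 [Phi2 Psi2]];
    split; intros G N; cbn [Phi Psi cbn_ty cbv_ty] in *.
  1-4: symmetry; apply cmp_id_l.
  - change (phi (sprod t1 t2)) with (phi_prod (phi t1) (phi t2)).
    etransitivity; [|symmetry; apply phi_prod_cmp].
    rewrite icomp_cpair; f_equal; rewrite icomp_to, icomp_match, ?Phi1, ?Phi2;
      cbn; cart; reflexivity.
  - change (psi (sprod t1 t2)) with (psi_prod (psi t1) (psi t2)).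
    etransitivity; [|symmetry; apply psi_prod_cmp].
    rewrite !icomp_to, Psi1, Psi2. cbn. rewrite icomp_cwk. cart. reflexivity.
  - change (phi (sarr t1 t2)) with (phi_arr (psi t1) (phi t2)).
    etransitivity; [|symmetry; apply phi_arr_cmp].
    rewrite icomp_lam. f_equal. rewrite !icomp_to, icomp_cwk, Psi1, Phi2, icomp_app.
    cbn. cart. reflexivity.
  - change (psi (sarr t1 t2)) with (psi_arr (phi t1) (psi t2)).
    etransitivity; [|symmetry; apply psi_arr_cmp].
    rewrite icomp_ret. cbn [ival]. rewrite icomp_lam. do 2 f_equal.
    rewrite Psi2, icomp_app, icomp_cwk. cbn [ival]. rewrite Phi1. cbn.
    unfold uncurry. cart. reflexivity.
Qed.

Fixpoint phi_hat (G : list sty) :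
    Hom (ictx M (cbv_ctx G)) (ictx M (cbn_ctx G)) :=
  match G with
  | [] => idm one
  | t :: G => pmap (phi_hat G) (phi t ∘ eta TT _)
  end.

Lemma phi_hat_var G t (x : var G t) :
  ivar M (var_map (fun t => U (cbn_ty t)) x) ∘ phi_hat G
  = phi t ∘ eta TT _ ∘ ivar M (var_map cbv_ty x).
Proof.
  induction x as [G t|G t u x IH]; cbn.
  - cart. reflexivity.
  - cart. exact (f_equal (fun h => h ∘ pr1) IH).
Qed.

Lemma csub_Phi_hat G C (N : comp (cbn_ctx G) C) :
  icomp M (csub N (Phi_hat G)) = icomp M N ∘ phi_hat G.
Proof.
  (* By [var_map_ind] only translated variables matter, and on these [var_map_case_map] computes
     [Phi_hat]. *)
  apply sub_sem. apply var_map_ind. intros t x.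
  etransitivity; [apply (f_equal (@ival M _ _)), (var_map_case_map (f := fun t => U (cbn_ty t)))|].
  etransitivity; [|symmetry; apply phi_hat_var]. cbn [ival].
  rewrite (proj1 (Phi_Psi_sem t)), icomp_ret, cmp_assoc. reflexivity.
Qed.

(** * Comparison of the two translations *)

Lemma cbv_le_cbn (Hlax : lax_idempotent TT) G t (e : expr G t) :
  icomp M (cbv e) ⊑ psi t ∘ (icomp M (cbn e) ∘ phi_hat G).
Proof.
  pose proof (reflects_phi_psi Hlax) as R.
  (* The adjoint transpose of an induction hypothesis, used for subterms of product and function
     type. *)
  assert (phi_le : forall G t (m : Hom (ictx M G) (T TT (ivty M (cbv_ty t)))) n,
    m ⊑ psi t ∘ n -> phi t ∘ m ⊑ n).
  { intros D u m n H. eapply hle_trans; [|apply (reflects_counit (R u))].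
    rewrite <- cmp_assoc. apply cmp_mono; [apply hle_refl | exact H]. }
  induction e as [G t x|G|G t1 t2 e1 IH1 e2 IH2|G t1 t2 e IH|G t1 t2 e IH|G|G
    |G t e0 IH0 e1 IH1 e2 IH2|G t t' e IH|G t t' e IH e' IH'];
    cbn [cbv cbn cbv_ty cbn_ty icty prod_alg free_alg power_alg carrier ivty] in *.
  - eapply hle_trans; [apply (reflects_unit Hlax (R t))|].
    rewrite <- cmp_assoc. apply cmp_mono; [apply hle_refl|].
    apply eq_hle. etransitivity; [|symmetry; apply phi_hat_var]. apply cmp_assoc.
  - apply eq_hle. cbn. cart. rewrite <- cmp_assoc. do 2 f_equal. apply bang_eq.
  - change (psi (sprod t1 t2)) with (psi_prod (psi t1) (psi t2)).
    rewrite icomp_cpair, pairing_cmp, psi_prod_cmp, !icomp_to, icomp_cwk.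
    apply (bind_mono (Z := free_alg TT _)).
    + cart. rewrite <- cmp_assoc. exact IH1.
    + apply (bind_mono (Z := free_alg TT _)); [|apply hle_refl].
      cart. rewrite <- (cmp_assoc (psi t2)).
      apply cmp_mono; [exact IH2 | apply hle_refl].
  (* The middle term projects the converted by-value pair. Its lower bound comes from moving
     [psi t1] into the binding of [phi_prod] by [bind_cmp_lax], its upper bound from [phi_le]. *)
  - apply hle_trans with
      (psi t1 ∘ (pr1 ∘ (phi_prod (phi t1) (phi t2) ∘ icomp M (cbv e)))).
    + rewrite phi_prod_cmp, pr1_pairing.
      eapply hle_trans; [|apply (bind_cmp_lax Hlax (Z' := free_alg TT _))].
      rewrite icomp_to. apply (bind_mono (Z := free_alg TT _)); [apply hle_refl|].
      eapply hle_trans; [apply (reflects_unit Hlax (R t1))|].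
      apply eq_hle. rewrite icomp_match. cbn. cart. reflexivity.
    + apply cmp_mono; [apply hle_refl|]. cbn [icomp]. rewrite <- cmp_assoc.
      apply cmp_mono; [apply hle_refl|]. apply (phi_le _ (sprod t1 t2)), IH.
  - apply hle_trans with
      (psi t2 ∘ (pr2 ∘ (phi_prod (phi t1) (phi t2) ∘ icomp M (cbv e)))).
    + rewrite phi_prod_cmp, pr2_pairing.
      eapply hle_trans; [|apply (bind_cmp_lax Hlax (Z' := free_alg TT _))].
      rewrite icomp_to. apply (bind_mono (Z := free_alg TT _)); [apply hle_refl|].
      eapply hle_trans; [apply (reflects_unit Hlax (R t2))|].
      apply eq_hle. rewrite icomp_match. cbn. cart. reflexivity.
    + apply cmp_mono; [apply hle_refl|]. cbn [icomp]. rewrite <- cmp_assoc.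
      apply cmp_mono; [apply hle_refl|]. apply (phi_le _ (sprod t1 t2)), IH.
  - apply eq_hle. cbn. cart. rewrite <- !cmp_assoc. do 2 f_equal. apply bang_eq.
  - apply eq_hle. cbn. cart. rewrite <- !cmp_assoc. do 2 f_equal. apply bang_eq.
  (* [psi sbool] is the identity, so the conditions compare directly; [psi t] then moves out of the
     binding and out of both branches. *)
  - change (psi sbool) with (idm (T TT (two M))) in IH0. rewrite cmp_id_l in IH0.
    rewrite !icomp_to, !icomp_if, !icomp_cwk, bind_cmp.
    eapply hle_trans; [|apply (bind_cmp_lax Hlax (Z' := free_alg TT _))].
    apply (bind_mono (Z := free_alg TT _)); [exact IH0|].
    apply hle_trans with
      (split_two (two M) (psi t ∘ (icomp M (cbn e1) ∘ phi_hat G) ∘ pr1)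
         (psi t ∘ (icomp M (cbn e2) ∘ phi_hat G) ∘ pr1) ∘ ⟨idm _, pr2⟩).
    + apply cmp_mono; [|apply hle_refl].
      apply split_two_mono; (apply cmp_mono; [assumption | apply hle_refl]).
    + apply eq_hle. rewrite <- !split_two_cmp, <- !cmp_split_two, <- split_two_cmp.
      cbn. cart. reflexivity.
  - change (psi (sarr t t')) with (psi_arr (phi t) (psi t')).
    (* On the extended context [phi_hat] supplies the very argument [phi t ∘ eta] that [psi_arr]
       passes to the function. *)
    rewrite icomp_lam, psi_arr_cmp, icomp_ret. apply cmp_mono; [apply hle_refl|].
    cbn [ival]. rewrite icomp_lam. apply curry_mono.
    eapply hle_trans; [exact IH|]. apply eq_hle.
    rewrite uncurry_cmp, uncurry_curry. cbn [phi_hat]. cart. reflexivity.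
  (* The middle term applies the converted function to the unevaluated argument. [phi_arr] evaluates
     function and argument in the order of by-value application, and [psi t'] moves out past the two
     bindings. *)
  - apply hle_trans with
      (psi t' ∘ (ev ∘ ⟨phi_arr (psi t) (phi t') ∘ icomp M (cbv e),
                       icomp M (cbn e') ∘ phi_hat G⟩)).
    + rewrite phi_arr_cmp, <- (cmp_id_r (curry _)), ev_curry_pairing, bind_cmp.
      eapply hle_trans; [|apply (bind_cmp_lax Hlax (Z' := free_alg TT _))].
      rewrite !icomp_to, icomp_cwk, icomp_app.
      apply (bind_mono (Z := free_alg TT _)); [cart; apply hle_refl|].
      rewrite bind_cmp.
      eapply hle_trans; [|apply (bind_cmp_lax Hlax (Z' := free_alg TT _))].
      apply (bind_mono (Z := free_alg TT _)).
      * cart. apply cmp_mono; [|apply hle_refl]. rewrite <- cmp_assoc. exact IH'.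
      * eapply hle_trans; [apply (reflects_unit Hlax (R t'))|].
        apply eq_hle. cbn. cart. reflexivity.
    + apply cmp_mono; [apply hle_refl|]. rewrite icomp_app, <- cmp_assoc, pairing_cmp.
      apply cmp_mono; [apply hle_refl|]. apply pairing_mono; [|apply hle_refl].
      apply (phi_le _ (sarr t t')), IH.
Qed.

End Semantics.

Theorem theorem6p2 (M : Model) (R : program -> program -> Prop)
    (HR : preorder program R)
    (Hadequate : adequate M R)
    (Hlax : lax_idempotent (monad M))
    (G : list sty) (t : sty) (e : expr G t) :
  ctx_le R (cbv e) (Psi t (csub (cbn e) (Phi_hat G))).
Proof.
  apply Hadequate. rewrite (proj2 (Phi_Psi_sem M t)), csub_Phi_hat.
  apply cbv_le_cbn, Hlax.
Qed.
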